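(* Let $\Pi_{\mathrm{Fix}}$ be a hwise-fixed-5-space. Then $\Pi_{\mathrm{Fix}}$ contains exactly - $(\mathrm n+1)(q^2+q+1)$ fixed points, $(q-\mathrm n)(q^2+q+1)$ I$_{\vdots}$-points and $(q^3-q)(q^2+q+1)$ II$_{\vdots}$-points; - $(\mathrm n+1)(q^2+q+1)$ ptwise-fixed lines, $q^2+q+1$ fixed-I-lines and $(q^3-q)(q^2+q+1)/(q-\mathrm n)$ fixed-II-lines; - $\mathrm n+1$ ptwise-fixed planes, and it is disjoint from the remaining $\mathrm g-(\mathrm n+1)$ ptwise-fixed planes.
   Context: Let $q>2$ be a prime power, $\mathrm n\in\{-1,0,1\}$ with $q\equiv\mathrm n\pmod 3$, $\mathrm g=\gcd(3,q-1)$. Let $\phi$ be a collineation of $\mathrm{PG}(2,q^3)$ of order 3 fixing pointwise an $\mathbb F_q$-subplane $\mathcal P_{2,q}$. A point $\bar P$ of $\mathrm{PG}(2,q^3)$ has Type I if in $\mathcal P_{2,q}$, Type II if $\bar P,\bar P^\phi,\bar P^{\phi^2}$ are distinct and collinear, Type III if non-collinear. Bose representation: identifying $\mathbb F_{q^3}^3$ with $\mathbb F_q^9$, each point $\bar P$ corresponds to a plane $[\![P]\!]$ of $\mathrm{PG}(8,q)$; a point of $\mathrm{PG}(8,q)$ is an X-point if it lies in $[\![P]\!]$ with $\bar P$ of Type X. $\phi$ induces a projectivity $\sigma$ of $\mathrm{PG}(8,q)$ of order 3 with $[\![P]\!]^\sigma=[\![P^\phi]\!]$. A fixed point is a point fixed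 by $\sigma$; a I-point $A$ is a I$_{\vdots}$-point if $A,A^\sigma,A^{\sigma^2}$ are distinct and collinear; a II-point $B$ is a II$_{\vdots}$-point if $B,B^\sigma,B^{\sigma^2}$ are collinear. Ptwise-fixed lines/planes are lines/planes fixed pointwise by $\sigma$ (there are exactly $\mathrm g$ ptwise-fixed planes). A fixed-I-line (fixed-II-line) is a $\sigma$-fixed line containing a I$_{\vdots}$-point (II$_{\vdots}$-point). A hwise-fixed-5-space is a 5-space $\Pi$ such that every 6-space containing $\Pi$ is fixed by $\sigma$. *)

(* Defs.v *)
From HB Require Import structures.
From mathcomp Require Import all_boot all_order all_fingroup all_algebra.

Set Implicit Arguments.
Unset Strict Implicit.
Unset Printing Implicit Defensive.

Import GRing.Theory.
Local Open Scope ring_scope.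

Section FinVspace.
(* For the subType structure of {vspace V} over matrices. *)
Import VectorInternalTheory.
Variables (K : finFieldType) (V : vectType K).

HB.instance Definition _ := [Countable of {vspace V} by <:].
HB.instance Definition _ := [Finite of {vspace V} by <:].

End FinVspace.

(* PG(V) is the lattice of subspaces of V; k is the projective dimension. *)
Definition kspace (K : fieldType) (V : vectType K) (k : nat) (U : {vspace V}) :=
  \dim U == k.+1.

Section ProjectiveGeometry.
Variables (K : finFieldType) (V : vectType K).
Implicit Types (A B C U W : {vspace V}) (f : {perm {vspace V}}).

Definition is_point U := kspace 0 U.
Definition is_line U := kspace 1 U.
Definition is_plane U := kspace 2 U.

Definition collinear A B C := (\dim (A + B + C) <= 2)%N.

Definition collineation f := {mono f : U W / (U <= W)%VS}.

Definition projectivity f :=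
  exists s : 'End(V), lker s == 0%VS /\ forall U, f U = (s @: U)%VS.

Definition distinct_orbit f A := uniq [:: A; f A; f (f A)].
Definition collinear_orbit f A := collinear A (f A) (f (f A)).

Definition ptwise_fixed f U :=
  [forall A : {vspace V}, is_point A && (A <= U)%VS ==> (f A == A)].

Definition hwise_fixed_5space f U :=
  kspace 5 U /\ forall W, kspace 6 W -> (U <= W)%VS -> f W = W.

End ProjectiveGeometry.

Section Bose.
Variables (F L : finFieldType) (iota : {rmorphism F -> L}).
Variable theta : {linear 'rV[F]_9 -> 'rV[L]_3 | iota \; *:%R}.
Variables (S : {set {vspace 'rV[L]_3}}) (phi : {perm {vspace 'rV[L]_3}}).
Variable sigma : {perm {vspace 'rV[F]_9}}.
Implicit Types (P : {vspace 'rV[L]_3}) (A l U : {vspace 'rV[F]_9}).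

(* Homogeneous coordinates over F with respect to the rows of M. *)
Definition Fq_subplane :=
  exists2 M : 'M[L]_3, M \in unitmx &
    S = [set <[map_mx iota x *m M]>%VS | x : 'rV[F]_3 & x != 0].

Definition typeI P := is_point P && (P \in S).
Definition typeII P :=
  [&& is_point P, distinct_orbit phi P & collinear_orbit phi P].

(* The spanning family is already closed under F-linear combinations; see
   mem_bose. *)
Definition bose P : {vspace 'rV[F]_9} :=
  <<enum [pred x : 'rV[F]_9 | theta x \in P]>>%VS.

Lemma mem_bose P x : (x \in bose P) = (theta x \in P).
Proof.
apply/idP/idP => [/coord_span -> | xP]; last by apply: memv_span; rewrite mem_enum.
rewrite linear_sum; apply: rpred_sum => i _.
rewrite linearZ_LR /=; apply: rpredZ.
set e := enum _; have : e`_i \in e by apply: mem_nth; rewrite -cardE.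
by rewrite mem_enum.
Qed.

Definition I_point A :=
  is_point A && [exists P : {vspace 'rV[L]_3}, typeI P && (A <= bose P)%VS].
Definition II_point A :=
  is_point A && [exists P : {vspace 'rV[L]_3}, typeII P && (A <= bose P)%VS].

Definition fixed_point A := is_point A && (sigma A == A).
Definition I_dots_point A :=
  [&& I_point A, distinct_orbit sigma A & collinear_orbit sigma A].
Definition II_dots_point A := II_point A && collinear_orbit sigma A.

Definition ptwise_fixed_line l := is_line l && ptwise_fixed sigma l.
Definition ptwise_fixed_plane U := is_plane U && ptwise_fixed sigma U.
Definition fixed_I_line l :=
  [&& is_line l, sigma l == l &
      [exists A : {vspace 'rV[F]_9}, I_dots_point A && (A <= l)%VS]].
Definition fixed_II_line l :=
  [&& is_line l, sigma l == l &
      [exists A : {vspace 'rV[F]_9}, II_dots_point A && (A <= l)%VS]].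

End Bose.

Definition count_in (K : finFieldType) (V : vectType K)
    (U : {vspace V}) (p : pred {vspace V}) : rat :=
  #|[set W : {vspace V} | (W <= U)%VS && p W]|%:R.

(* Main.v *)
Require Import Defs.
From HB Require Import structures.
From mathcomp Require Import all_boot all_order all_fingroup all_algebra.
From mathcomp Require Import cyclic pgroup finfield ring zify.
Import GRing.Theory.
Local Open Scope ring_scope.

(** Through theta, sigma is induced by an additive bijection of L^3 mapping
    points to points; as it fixes the F-subplane pointwise, in the coordinates
    of the subplane it is x |-> c tau(x) for an automorphism tau of order 3 of L
    with fixed field F.  A hwise-fixed 5-space Pi forces the F-linear map s
    inducing sigma to be a scalar k modulo Pi, so c / k has norm 1 and, by
    Hilbert 90, after rescaling s is tau acting coordinatewise.  Then
    Pi = im (s - 1) = ker (1 + s + s^2) is the space of vectors whose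
    coordinates have trace 0, and the ptwise-fixed planes are the eigenspaces of s for the
    cube roots of unity of F; those inside Pi belong to the n + 1 roots of
    X^2 + X + 1 in F.

    A nonzero x in Pi has a collinear orbit under sigma, is a fixed point iff it
    is an eigenvector, and is a I-point iff it is an L-multiple of a rational
    vector; otherwise it is a II-point.  All points are counted through these
    vectors.  The fixed-I- and fixed-II-lines are the spans of x and s x for x
    not an eigenvector, and each contains exactly q - n non-fixed points, all
    of the same kind. *)

(** * Counting points and lines *)

Lemma card_fibers (A B : finType) (f : A -> B) (D : {set A}) m :
    (forall x, x \in D -> #|[set y in D | f y == f x]| = m) ->
  #|D| = (#|f @: D| * m)%N.
Proof.
move=> fib; rewrite -sum1_card (partition_big_imset f) /= -sum_nat_const.
apply: eq_bigr => z /imsetP[x xD ->]; rewrite sum1dep_card -(fib x xD).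
by apply: eq_card => y; rewrite !inE.
Qed.

Lemma card_bigcup_uniform (I T : finType) (R : {set I}) (A : I -> {set T}) m :
    (forall i, i \in R -> #|A i| = m) ->
    (forall i j x, i \in R -> j \in R -> x \in A i -> x \in A j -> i = j) ->
  #|\bigcup_(i in R) A i| = (#|R| * m)%N.
Proof.
move=> cardA inj; pose D := [set u : I * T | (u.1 \in R) && (u.2 \in A u.1)].
have -> : \bigcup_(i in R) A i = snd @: D.
  apply/setP=> x; apply/bigcupP/imsetP => [[i iR xA]|[[i y]]].
    by exists (i, x) => //; rewrite inE iR.
  by rewrite inE => /andP[/= iR yA] ->; exists i.
rewrite card_in_imset; last first.
  move=> [i x] [j y]; rewrite !inE /= => /andP[iR xA] /andP[jR yA] eq_xy.
  by rewrite -eq_xy in yA *; rewrite (inj i j x).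
rewrite -sum1_card (eq_bigl (fun u => (u.1 \in R) && (u.2 \in A u.1))); last first.
  by move=> u; rewrite inE.
rewrite -(pair_big_dep (mem R) (fun i => mem (A i)) (fun _ _ => 1%N)) /=.
rewrite -sum_nat_const; apply: eq_bigr => i iR.
by rewrite sum1_card cardA.
Qed.

Section CountSubspaces.
Variables (F : finFieldType) (m : nat).
Let V := 'rV[F]_m.
Implicit Types (x y : V) (U l : {vspace V}).

Lemma card_mem_vspace U : #|[set x : V in U]| = (#|F| ^ \dim U)%N.
Proof. by rewrite cardsE; exact: card_vspace. Qed.

Lemma card_mem_vspaceD0 U : #|[set x : V in U | x != 0]| = (#|F| ^ \dim U - 1)%N.
Proof.
rewrite -card_mem_vspace (cardsD1 0 [set x : V in U]) inE mem0v add1n subn1 /=.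
by apply: eq_card => x; rewrite !inE andbC.
Qed.

Lemma dim_vspace_card U k : #|[set x : V in U]| = (#|F| ^ k)%N -> \dim U = k.
Proof. by rewrite card_mem_vspace => /expnI; apply; exact: finNzRing_gt1. Qed.

Lemma is_pointP U : reflect (exists2 x, x != 0 & U = <[x]>%VS) (is_point U).
Proof.
apply: (iffP eqP) => [dimU|[x x0 ->]]; last by rewrite dim_vline x0.
have U0 : U != 0%VS by rewrite -dimv_eq0 dimU.
exists (vpick U); first by rewrite vpick0.
by apply/esym/eqP; rewrite eqEdim -memvE memv_pick dim_vline vpick0 U0 dimU.
Qed.

Lemma vline_eqE x y : y != 0 -> (<[y]> == <[x]>)%VS = (y \in <[x]>%VS).
Proof.
move=> y0; apply/eqP/idP => [<-|yx]; first exact: memv_line.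
apply/eqP; rewrite eqEdim -memvE yx !dim_vline y0.
by case: (x != 0).
Qed.

Lemma vline_scale (a : F) x : a != 0 -> <[a *: x]>%VS = <[x]>%VS.
Proof.
move=> a0; have [-> |x0] := eqVneq x 0; first by rewrite scaler0.
by apply/eqP; rewrite vline_eqE ?scaler_eq0 ?negb_or ?a0 // memvZ ?memv_line.
Qed.

(** Each point is spanned by [#|F| - 1] nonzero vectors, the fibre of the map from a vector to its
    span. The product form avoids a division in the naturals. *)
Lemma card_points (p : pred {vspace V}) :
  (#|[set A | is_point A && p A]| * (#|F| - 1))%N
    = #|[set x : V | (x != 0) && p <[x]>%VS]|.
Proof.
pose f x : {vspace V} := <[x]>%VS.
rewrite (@card_fibers _ _ f _ (#|F| - 1)%N) => [|x].
  congr (_ * _)%N; apply: eq_card => A; rewrite inE.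
  apply/andP/imsetP => [[/is_pointP[x x0 ->] pA]|[x]].
    by exists x; rewrite // inE x0.
  rewrite inE => /andP[x0 px] ->; split=> //.
  by apply/is_pointP; exists x.
rewrite inE => /andP[x0 px].
transitivity #|[set y : V in <[x]>%VS | y != 0]|.
  apply: eq_card => y; rewrite !inE /f andbC [RHS]andbC.
  case y0: (y != 0) => /=; last by rewrite andbF.
  rewrite vline_eqE //; case yx: (y \in _) => //=.
  by have /eqP-> : (<[y]> == <[x]>)%VS by rewrite vline_eqE // y0.
by rewrite card_mem_vspaceD0 dim_vline x0 expn1.
Qed.

Definition line_thru x y : {vspace V} := (<[x]> + <[y]>)%VS.

Lemma dim_line_thru x y : x != 0 -> y \notin <[x]>%VS -> \dim (line_thru x y) = 2%N.
Proof.
move=> x0 yx; have y0 : y != 0 by apply: contraNneq yx => ->; rewrite mem0v.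
rewrite dimv_disjoint_sum ?dim_vline ?x0 ?y0 //.
apply/eqP; rewrite -subv0; apply/subvP=> z; rewrite memv_cap => /andP[zx /vlineP[k]].
move=> zE; rewrite zE in zx *; case: (eqVneq k 0) => [->|k0].
  by rewrite scale0r mem0v.
by move: zx; rewrite rpredZeq (negPf k0) (negPf yx).
Qed.

(** The ordered pairs of independent vectors of [U], that is, the ordered bases of its lines. *)
Definition frames U : {set V * V} :=
  [set u : V * V | [&& u.1 \in U, u.2 \in U, u.1 != 0 & u.2 \notin <[u.1]>%VS]].

Lemma card_frames U :
  #|frames U| = ((#|F| ^ \dim U - 1) * (#|F| ^ \dim U - #|F|))%N.
Proof.
rewrite -sum1_card (eq_bigl (fun u : V * V => (u.1 \in [set x : V in U | x != 0]) &&
  (u.2 \in [set x : V in U | x \notin <[u.1]>%VS]))); last first.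
  by move=> u; rewrite !inE -!andbA; do !bool_congr.
rewrite -(pair_big_dep (mem [set x : V in U | x != 0])
  (fun x => mem [set y : V in U | y \notin <[x]>%VS]) (fun _ _ => 1%N)) /=.
rewrite -card_mem_vspaceD0 -sum_nat_const; apply: eq_bigr => x.
rewrite inE => /andP[xU x0]; rewrite sum1_card.
have cx : #|[set y : V in <[x]>%VS]| = #|F| by rewrite card_mem_vspace dim_vline x0.
rewrite -[in RHS]card_mem_vspace -[X in (_ - X)%N]cx -cardsDS; last first.
  by apply/subsetP=> y; rewrite !inE => /vlineP[k ->]; rewrite memvZ.
by apply: eq_card => y; rewrite !inE andbC.
Qed.

Lemma line_thru_sub x y U : (line_thru x y <= U)%VS = (x \in U) && (y \in U).
Proof. by rewrite subv_add -!memvE. Qed.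

Lemma mem_line_thrul x y : x \in line_thru x y.
Proof. by have := line_thru_sub x y (line_thru x y); rewrite subvv => /esym/andP[]. Qed.

Lemma mem_line_thrur x y : y \in line_thru x y.
Proof. by have := line_thru_sub x y (line_thru x y); rewrite subvv => /esym/andP[]. Qed.

Lemma line_thru_eq x y U : \dim U = 2%N -> x \in U -> y \in U -> x != 0 ->
  y \notin <[x]>%VS -> line_thru x y = U.
Proof.
move=> dimU xU yU x0 yx; apply/eqP.
by rewrite eqEdim line_thru_sub xU yU dim_line_thru ?dimU.
Qed.

Lemma mem_line_thruP x y z :
  reflect (exists a b, z = a *: x + b *: y) (z \in line_thru x y).
Proof.
apply: (iffP memv_addP) => [[_ /vlineP[a ->] [_ /vlineP[b ->] ->]]|[a [b ->]]].
  by exists a, b.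
exists (a *: x); first by rewrite memvZ ?memv_line.
by exists (b *: y); first by rewrite memvZ ?memv_line.
Qed.

Lemma frame_factor_gt0 q : (1 < q -> 0 < (q ^ 2 - 1) * (q ^ 2 - q))%N.
Proof.
move=> q1; rewrite muln_gt0 !subn_gt0 -{1}(expn0 q).
by rewrite -[X in _ && (X < _)%N](expn1 q) !ltn_exp2l.
Qed.

Lemma line_frame U : \dim U = 2%N ->
  exists x y, [/\ x \in U, y \in U, x != 0 & y \notin <[x]>%VS].
Proof.
move=> dimU; have: (0 < #|frames U|)%N.
  by rewrite card_frames dimU frame_factor_gt0 // finNzRing_gt1.
by case/card_gt0P=> -[x y]; rewrite inE => /and4P[]; exists x, y.
Qed.

(** Double counting: every frame of [U] spans one line, and every line has as many frames as any
    other 2-dimensional space. *)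
Lemma card_lines U : \dim U = 3%N ->
  #|[set l : {vspace V} | (l <= U)%VS && is_line l]| = (#|F| ^ 2 + #|F| + 1)%N.
Proof.
move=> dimU; pose f (u : V * V) := line_thru u.1 u.2.
have := @card_fibers _ _ f (frames U) ((#|F| ^ 2 - 1) * (#|F| ^ 2 - #|F|))%N.
have -> : f @: frames U = [set l | (l <= U)%VS && is_line l].
  apply/setP=> l; rewrite inE; apply/imsetP/andP => [[[x y]]|[lU /eqP dl]].
    rewrite inE => /and4P[/= xU yU x0 yx] ->.
    by rewrite /f line_thru_sub xU yU /is_line /kspace dim_line_thru.
  have [x [y [xl yl x0 yx]]] := line_frame _ dl.
  exists (x, y); last by rewrite /f (line_thru_eq _ _ l).
  by rewrite inE /= (subvP lU) // (subvP lU) // x0.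
rewrite card_frames dimU => H.
have {}/H : forall u, u \in frames U ->
  #|[set v in frames U | f v == f u]| = ((#|F| ^ 2 - 1) * (#|F| ^ 2 - #|F|))%N.
  move=> [x y]; rewrite inE => /and4P[/= xU yU x0 yx].
  have dl := dim_line_thru x y x0 yx.
  transitivity #|frames (line_thru x y)|; last by rewrite card_frames dl.
  apply: eq_card => -[z t]; rewrite !inE /f /=.
  apply/andP/and4P => [[/and4P[zU tU z0 tz] /eqP <-]|[zl tl z0 tz]].
    by split; rewrite ?mem_line_thrul ?mem_line_thrur.
  have lU : (line_thru x y <= U)%VS by rewrite line_thru_sub xU.
  by rewrite !(subvP lU) // z0 tz (line_thru_eq _ _ (line_thru x y)).
set N := #|_|; have := finNzRing_gt1 F.
move: #|F| N => q N q1 H; apply/eqP.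
rewrite -(eqn_pmul2r (frame_factor_gt0 _ q1)) -H; apply/eqP.
(* Substituting [q = k + 2] turns each truncated difference into a polynomial in [k] with
   nonnegative coefficients, which [ring] can handle. *)
have [k ->] : exists k, q = (k + 2)%N by exists (q - 2)%N; lia.
have -> : ((k + 2) ^ 3 - 1 = (k + 1) * ((k + 2) ^ 2 + (k + 2) + 1))%N.
  by rewrite (_ : ((k + 2) ^ 3 = (k + 1) * ((k + 2) ^ 2 + (k + 2) + 1) + 1)%N) ?addnK //; ring.
have -> : ((k + 2) ^ 3 - (k + 2) = (k + 1) * (k + 2) * (k + 3))%N.
  by rewrite (_ : ((k + 2) ^ 3 = (k + 1) * (k + 2) * (k + 3) + (k + 2))%N) ?addnK //; ring.
have -> : ((k + 2) ^ 2 - 1 = (k + 1) * (k + 3))%N.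
  by rewrite (_ : ((k + 2) ^ 2 = (k + 1) * (k + 3) + 1)%N) ?addnK //; ring.
have -> : ((k + 2) ^ 2 - (k + 2) = (k + 1) * (k + 2))%N.
  by rewrite (_ : ((k + 2) ^ 2 = (k + 1) * (k + 2) + (k + 2))%N) ?addnK //; ring.
ring.
Qed.

End CountSubspaces.
Lemma dim_line_thru_le (F : finFieldType) m (x y : 'rV[F]_m) :
  (\dim (line_thru F m x y) <= 2)%N.
Proof.
apply: leq_trans (dimv_add_leqif _ _).1 _; rewrite !dim_vline.
by case: (x != 0); case: (y != 0).
Qed.

(** Meant for [y = s x] with [x + s x + s (s x) = 0]: the third vector is then [s (s x)], so the
    orbit of the point is collinear. *)
Lemma collinear_vlines (F : finFieldType) m (x y : 'rV[F]_m) :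
  collinear <[x]>%VS <[y]>%VS <[- x - y]>%VS.
Proof.
rewrite /collinear; apply: leq_trans (dim_line_thru_le F m x y); apply: dimvS.
by rewrite subv_add subvv -memvE memvB ?rpredN ?mem_line_thrul ?mem_line_thrur.
Qed.

(** Orbits of a permutation of order 3 have length 1 or 3. *)
Lemma distinct_orbitE (K : finFieldType) (V : vectType K) (f : {perm {vspace V}}) A :
  #[f]%g = 3%N -> distinct_orbit f A = (f A != A).
Proof.
move=> of3; have f3 B : f (f (f B)) = B.
  have := expg_order f; rewrite of3 => /permP/(_ B).
  by rewrite permX perm1.
rewrite /distinct_orbit /= !inE negb_or andbT (inj_eq perm_inj) [A == f A]eq_sym.
case: (eqVneq (f A) A) => //= fA; rewrite andbT; apply/eqP => E.
by case/eqP: fA; rewrite {1}E f3.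
Qed.

(** * Cube roots of unity in a finite field *)

Section Roots.
Variable F : finFieldType.

(** In characteristic 3 this set is {1}, whose element is not a primitive root. In every
    characteristic its size is n + 1, for n in {-1, 0, 1} congruent to [#|F|] modulo 3. *)
Definition prim_cube_roots : {set F} := [set k : F | k ^+ 2 + k + 1 == 0].
Definition cube_roots : {set F} := [set k : F | k ^+ 3 == 1].

Lemma prim_cube_rootE (k : F) : k ^+ 2 + k + 1 = 0 -> k ^+ 3 = 1.
Proof.
move=> H; have : k ^+ 3 - 1 = (k - 1) * (k ^+ 2 + k + 1) by ring.
by rewrite H mulr0 => /subr0_eq.
Qed.

Lemma cube_roots_cons : cube_roots = 1 |: prim_cube_roots.
Proof.
apply/setP=> k; rewrite !inE -subr_eq0.
have -> : k ^+ 3 - 1 = (k - 1) * (k ^+ 2 + k + 1) by ring.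
by rewrite mulf_eq0 subr_eq0.
Qed.

(** The polynomial takes the value 3 at 1, and 3 vanishes exactly when 1 has additive order 3. *)
Lemma mem1_prim_cube_roots : (1 \in prim_cube_roots) = (3 %| #|F|)%N.
Proof.
have three : 1 ^+ 2 + 1 + 1 = 3%:R :> F by ring.
rewrite inE three -cardsT; apply/eqP/idP => [F3|].
  have <- : #[(1%R : F)]%g = 3%N.
    apply/(prime_nt_dvdP _ _) => //; last first.
      by rewrite order_dvdn; apply/eqP; exact: F3.
    by rewrite order_eq1 oner_eq0.
  exact: (order_dvdG (in_setT _)).
case/(Cauchy (isT : prime 3)) => x _ ox.
have x0 : x != 0 by apply/eqP=> x0; move: ox; rewrite x0 order1.
apply: (mulIf x0); rewrite mul0r mulr_natl.
by have := expg_order x; rewrite ox FinRing.zmodXgE.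
Qed.

Lemma cube_root_card (k : F) : k ^+ 3 = 1 -> k != 1 -> (3 %| #|F|.-1)%N.
Proof.
move=> k3 k1; have ku : k \is a GRing.unit.
  by rewrite unitfE; apply: contra_eq_neq k3 => ->; rewrite expr0n /= eq_sym oner_neq0.
pose u : {unit F} := FinRing.Unit ku.
rewrite -card_finField_unit.
have <- : #[u]%g = 3%N.
  apply/(prime_nt_dvdP _ _) => //; last first.
    by rewrite order_dvdn; apply/eqP/val_inj; rewrite FinRing.val_unitX.
  by rewrite order_eq1; apply: contra k1 => /eqP/(congr1 val)/= ->.
exact: (order_dvdG (in_setT u)).
Qed.

(** In characteristic 3 the polynomial is the square of X - 1. Otherwise its roots are the units of
    order 3, which exist exactly when 3 divides [#|F| - 1]; one root [u] brings the second root
    [- 1 - u]. *)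
Lemma card_prim_cube_roots :
  [/\ (#|F| = 0 %[mod 3] -> #|prim_cube_roots| = 1)%N,
      (#|F| = 1 %[mod 3] -> #|prim_cube_roots| = 2)%N
    & (#|F| = 2 %[mod 3] -> #|prim_cube_roots| = 0)%N].
Proof.
have F1 := finNzRing_gt1 F; split=> Fmod.
- have H3 : 1 ^+ 2 + 1 + 1 = 0 :> F.
    have := mem1_prim_cube_roots; rewrite /dvdn Fmod inE => /eqP/eqP H.
    by apply/eqP; rewrite H.
  apply/eqP/cards1P; exists 1; apply/setP=> k.
  rewrite !inE -[k == 1]subr_eq0 -[_ - _ == _]sqrf_eq0.
  congr (_ == _); have -> : k ^+ 2 + k + 1 = (k - 1) ^+ 2 + (1 ^+ 2 + 1 + 1) * k by ring.
  by rewrite H3 mul0r addr0.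
- have: (3 %| #|[set: {unit F}]|)%N by rewrite card_finField_unit; lia.
  case/(Cauchy (isT : prime 3)) => u _ ou.
  have k1 : val u != 1.
    apply/eqP=> u1; have := ou; rewrite (_ : u = 1%g) ?order1 //; exact: val_inj.
  have k3 : (val u : F) ^+ 3 = 1 by rewrite -FinRing.val_unitX -ou expg_order.
  have kr : val u ^+ 2 + val u + 1 = 0 :> F.
    apply/eqP; have/eqP : (val u - 1) * (val u ^+ 2 + val u + 1) = 0 :> F.
      by rewrite (_ : _ * _ = (val u : F) ^+ 3 - 1); [rewrite k3 subrr | ring].
    by rewrite mulf_eq0 subr_eq0 (negPf k1).
  have -> : prim_cube_roots = [set (val u : F); - 1 - val u].
    apply/setP=> k; rewrite !inE.
    have -> : k ^+ 2 + k + 1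
        = (k - val u) * (k - (- 1 - val u)) + (val u ^+ 2 + val u + 1) by ring.
    by rewrite kr addr0 mulf_eq0 !subr_eq0.
  rewrite cards2; suff -> : val u != - 1 - val u by [].
  apply/eqP=> E; have := mem1_prim_cube_roots.
  have -> : (3 %| #|F|)%N = false by lia.
  move=> /negP; apply; rewrite inE.
  (* The discriminant is -3: with a double root both terms on the right vanish, so 3 would be zero
     in [F]. *)
  have -> : 1 ^+ 2 + 1 + 1
      = (val u ^+ 2 + val u + 1) *+ 4 - (val u - (- 1 - val u)) ^+ 2 :> F by ring.
  by rewrite kr {1}E subrr mul0rn expr0n subrr.
- apply/eqP; rewrite cards_eq0; apply/eqP/setP=> k; rewrite !inE; apply/negP=> /eqP kr.
  have k3 := prim_cube_rootE _ kr.
  case: (eqVneq k 1) => [k1|/(cube_root_card _ k3)]; last by lia.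
  by have := mem1_prim_cube_roots; rewrite inE -{1 2}k1 kr eqxx /dvdn Fmod.
Qed.

End Roots.

Lemma gcdn3_subn1 m : (0 < m)%N ->
  gcdn 3 (m - 1) = if (m %% 3 == 1)%N then 3%N else 1%N.
Proof.
move=> m0; case: eqP => E; first by apply/gcdn_idPl; lia.
by apply/eqP; rewrite -/(coprime _ _) prime_coprime //; apply/negP; lia.
Qed.

Lemma card_cube_roots (F : finFieldType) : #|cube_roots F| = gcdn 3 (#|F| - 1).
Proof.
have [r0 r1 r2] := card_prim_cube_roots F.
rewrite gcdn3_subn1; last exact: ltnW (finNzRing_gt1 F).
rewrite cube_roots_cons cardsU1 mem1_prim_cube_roots /dvdn.
have : (#|F| %% 3 < 3)%N by rewrite ltn_mod.
by case E: (#|F| %% 3)%N => [|[|[|//]]] _; rewrite ?(r0 E) ?(r1 E) ?(r2 E).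
Qed.

Lemma card_prim_cube_rootsZ (F : finFieldType) (n : int) :
    n \in [:: -1; 0; 1] -> (#|F|%:Z = n %[mod 3])%Z ->
  #|prim_cube_roots F|%:Z = n + 1.
Proof.
have [r0 r1 r2] := card_prim_cube_roots F.
rewrite !inE => /or3P[] /eqP -> E; [rewrite r2 // | rewrite r0 // | rewrite r1 //].
all: by move: E; rewrite modz_nat; case.
Qed.

(** * Automorphisms of order 3 *)

Section CubicAutomorphism.
Variables (F L : finFieldType) (iota : {rmorphism F -> L}).
Variable tau : {rmorphism L -> L}.
Hypothesis tau3 : forall x, tau (tau (tau x)) = x.
Hypothesis tau_iota : forall k, tau (iota k) = iota k.
Hypothesis tau_nontrivial : exists a, tau a != a.
Hypothesis cardL : #|L| = (#|F| ^ 3)%N.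

(** Dedekind independence of 1, [tau], [tau^2]. Replacing [x] by [a * x] and subtracting a multiple
    of the relation removes the last term; doing it again removes the middle one. *)
Lemma aut_independence (al be ga : L) :
  (forall x, al * x + be * tau x + ga * tau (tau x) = 0) -> al = 0.
Proof.
move=> H; have [a ta] := tau_nontrivial.
have tta : tau (tau a) != a.
  by apply: contra_neq ta => E; rewrite -{2}(tau3 a) E.
have H1 x : al * (a - tau (tau a)) * x + be * (tau a - tau (tau a)) * tau x = 0.
  have := congr2 (fun u v => u - v) (H (a * x)) (congr1 ( *%R (tau (tau a))) (H x)).
  by rewrite !rmorphM mulr0 subr0 => <-; ring.
have := congr2 (fun u v => u - v) (H1 a) (congr1 ( *%R (tau a)) (H1 1)).
rewrite rmorph1 mulr0 subr0.
rewrite (_ : _ - _ = al * (a - tau (tau a)) * (a - tau a)); last by ring.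
move/eqP; rewrite !mulf_eq0 !subr_eq0 ![a == _]eq_sym (negPf ta) (negPf tta).
by rewrite !orbF => /eqP.
Qed.

Lemma ex_aut_neq0 (be ga : L) : exists x, x + be * tau x + ga * tau (tau x) != 0.
Proof.
apply/existsP; rewrite -[X in is_true X]negbK negb_exists; apply/negP=> /forallP H.
have /eqP : 1 = 0 :> L; last by rewrite oner_eq0.
apply: (aut_independence 1 be ga) => x.
by rewrite mul1r; apply/eqP; rewrite -[X in is_true X]negbK H.
Qed.

(** The witness is the resolvent [x + c tau x + c tau(c) tau^2 x], nonzero for a suitable [x] by
    independence; applying [tau] and multiplying by [c] permutes its terms cyclically. *)
Lemma hilbert90 c : c * tau c * tau (tau c) = 1 ->
  exists2 b, b != 0 & c * tau b = b.
Proof.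
move=> Nc; have [x x0] := ex_aut_neq0 c (c * tau c).
exists (x + c * tau x + c * tau c * tau (tau x)) => //.
rewrite !(rmorphD, rmorphM) /= tau3 -[X in _ = X + _ + _]mul1r -Nc; ring.
Qed.

Lemma iota_inj : injective iota.
Proof. exact: fmorph_inj. Qed.

(** If [x] were fixed but not in the image of [iota], then 1, [x], [b], [x b] would be independent
    over [F] for any [b] moved by [tau]: a relation would write [b] as a quotient of fixed elements.
    This gives [#|F| ^ 4] elements in [L], too many. *)
Lemma tau_fixed x : tau x = x -> exists k, x = iota k.
Proof.
move=> tx; case: (boolP [exists k, x == iota k]) => [/existsP[k /eqP]|]; first by exists k.
rewrite negb_exists => /forallP xF; have [b tb] := tau_nontrivial.
pose f (u : (F * F) * (F * F)) :=
  (iota u.1.1 + iota u.1.2 * x) + (iota u.2.1 + iota u.2.2 * x) * b.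
have injx (k1 k2 l1 l2 : F) :
    iota k1 + iota k2 * x = iota l1 + iota l2 * x -> k1 = l1 /\ k2 = l2.
  move=> E; have {}E : iota (k1 - l1) = iota (l2 - k2) * x.
    rewrite !rmorphB; apply/eqP; rewrite -subr_eq0; apply/eqP.
    by move/eqP: E; rewrite -subr_eq0 => /eqP <-; ring.
  case: (eqVneq l2 k2) E => [-> |ne E].
    by rewrite subrr rmorph0 mul0r => /eqP; rewrite fmorph_eq0 subr_eq0 => /eqP.
  case/negP: (xF ((k1 - l1) / (l2 - k2))); apply/eqP.
  by rewrite fmorph_div E mulrC mulKf // fmorph_eq0 subr_eq0.
have injf : injective f.
  move=> [[k1 k2] [k3 k4]] [[l1 l2] [l3 l4]]; rewrite /f /= => E.
  pose y := iota k1 + iota k2 * x - (iota l1 + iota l2 * x).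
  pose z := iota l3 + iota l4 * x - (iota k3 + iota k4 * x).
  have ty : tau y = y by rewrite !(rmorphB, rmorphD, rmorphM) /= !tau_iota tx.
  have tz : tau z = z by rewrite !(rmorphB, rmorphD, rmorphM) /= !tau_iota tx.
  have yz : y = z * b.
    apply/eqP; rewrite -subr_eq0; apply/eqP; move/eqP: E; rewrite -subr_eq0 => /eqP <-.
    by rewrite /y /z; ring.
  have z0 : z = 0.
    apply: contraNeq tb => z0; rewrite -(inj_eq (mulfI z0)) -yz -ty yz rmorphM /=.
    by rewrite tz.
  have y0 : y = 0 by rewrite yz z0 mul0r.
  have [-> ->] := injx _ _ _ _ (subr0_eq y0).
  by have [-> ->] := injx _ _ _ _ (subr0_eq z0).
have := leq_card f injf; rewrite !card_prod cardL !mulnn -expnM leq_exp2l //.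
exact: finNzRing_gt1.
Qed.

Definition trace x := x + tau x + tau (tau x).

Lemma traceD : {morph trace : x y / x + y}.
Proof. by move=> x y; rewrite /trace !rmorphD; ring. Qed.

Lemma trace_iota k x : trace (x * iota k) = trace x * iota k.
Proof. by rewrite /trace !rmorphM /= !tau_iota; ring. Qed.

Lemma traceP x : exists k, trace x = iota k.
Proof. by apply: tau_fixed; rewrite /trace !rmorphD tau3 /=; ring. Qed.

(** Independence makes the trace nonzero somewhere, and its value there, lying in [F], can be scaled
    to 1. *)
Lemma trace_onto : exists a, trace a = 1.
Proof.
have [x x0] := ex_aut_neq0 1 1; rewrite !mul1r -/(trace x) in x0.
have [k xk] := traceP x; exists (x * iota k^-1).
by rewrite trace_iota xk -rmorphM mulfV ?rmorph1 // -(fmorph_eq0 iota) -xk.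
Qed.

(** The trace maps [L] onto the image of [F], and its fibres are translates of its kernel. *)
Lemma card_trace0 : #|[set x | trace x == 0]| = (#|F| ^ 2)%N.
Proof.
have := @card_fibers _ _ trace [set: L] #|[set x | trace x == 0]|.
rewrite cardsT cardL.
have -> : trace @: [set: L] = iota @: [set: F].
  apply/setP=> y; apply/imsetP/imsetP => [[x _ ->]|[k _ ->]].
    by have [k ->] := traceP x; exists k.
  have [a a1] := trace_onto; exists (a * iota k) => //.
  by rewrite trace_iota a1 mul1r.
rewrite card_imset; last exact: iota_inj.
rewrite cardsT => H; apply/eqP; rewrite -(eqn_pmul2l (ltnW (finNzRing_gt1 F))) -expnS.
rewrite H // => x _; rewrite -(card_imset [set y in _ | _] (addIr (- x))).
apply: eq_card => y; rewrite !inE; apply/imsetP/eqP => [[z]|y0].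
  rewrite !inE /= => /eqP zx ->; apply: (addIr (trace x)).
  by rewrite -traceD subrK zx add0r.
exists (y + x); last by rewrite addrK.
by rewrite !inE /= traceD y0 add0r.
Qed.

End CubicAutomorphism.

(** * Maps that are scalar on points *)

(** The factor [k] found at one [x0] with [f x0 != 0] serves everywhere. If [f y] is independent of
    [f x0], compare the factors at [x0], [y] and [x0 + y]; if it is dependent, subtract a multiple
    of [x0] and use that [g] vanishes on the kernel of [f]. *)
Lemma scalar_of_vlines (K : fieldType) (V W : vectType K) (f g : 'Hom(V, W)) :
    (forall x, g x \in <[f x]>%VS) ->
  exists k, forall x, g x = k *: f x.
Proof.
move=> gf; have f0 x : f x = 0 -> g x = 0.
  by move=> fx; have := gf x; rewrite fx => /vlineP[k ->]; rewrite scaler0.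
have [fz|/eqP fnz] := eqVneq f 0.
  by exists 0 => x; rewrite scale0r f0 // fz lfunE.
have [x0 fx0] : exists x0, f x0 != 0.
  exists (vpick (lker f)^C); rewrite -memv_ker; apply/negP => xk.
  have : vpick (lker f)^C \in (lker f :&: (lker f)^C)%VS by rewrite memv_cap xk memv_pick.
  rewrite capv_compl memv0 vpick0 => /eqP C0; apply: fnz.
  have kf : lker f = fullv by have := addv_complf (lker f); rewrite C0 addv0.
  by apply/lfunP=> x; rewrite lfunE; apply/eqP; rewrite -memv_ker kf memvf.
have /vlineP[k gk] := gf x0; exists k => y.
have [/vlineP[l fy]|fy] := boolP (f y \in <[f x0]>%VS).
  have /f0/eqP : f (y - l *: x0) = 0 by rewrite linearB linearZ /= fy subrr.
  by rewrite linearB linearZ /= gk subr_eq0 fy => /eqP ->; rewrite !scalerA mulrC.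
have /vlineP[l gy] := gf y; have /vlineP[h gxy] := gf (x0 + y).
have : (h - l) *: f y = (k - h) *: f x0.
  move: gxy; rewrite [g _]linearD [f _]linearD /= gk gy scalerDr => E.
  by apply/eqP; rewrite !scalerBl subr_eq addrAC E addrAC subrr add0r.
case: (eqVneq h l) => [-> |hl].
  rewrite subrr scale0r => /esym/eqP; rewrite scaler_eq0 (negPf fx0) orbF subr_eq0.
  by move/eqP=> ->.
move/(congr1 ( *:%R (h - l)^-1)); rewrite !scalerA mulVf ?subr_eq0 // scale1r => E.
by rewrite E memvZ ?memv_line in fy.
Qed.

(** The spaces of one dimension more than [U] are the points of the quotient by [U], so [s] fixes
    all points of the quotient and is a scalar there. The map [f], with kernel [U], stands for the
    quotient map. *)
Lemma scalar_mod_hwise_fixed (K : fieldType) (V : vectType K) (s : 'End(V))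
    (U : {vspace V}) :
    ((\dim U).+1 < \dim {: V})%N ->
    (forall W : {vspace V}, \dim W = (\dim U).+1 -> (U <= W)%VS -> (s @: W)%VS = W) ->
  exists k, forall x, s x - k *: x \in U.
Proof.
move=> dimU fixU; pose f : 'End(V) := (\1 - projv U)%VF.
have fE x : f x = x - projv U x by rewrite add_lfunE opp_lfunE id_lfunE.
have f0 x : (f x == 0) = (x \in U).
  rewrite fE subr_eq0; apply/eqP/idP => [-> |xU]; first exact: memv_proj.
  by rewrite projv_id.
have fW w z : w \notin U -> z \in (U + <[w]>)%VS -> f (s z) \in <[f w]>%VS.
  move=> wU zW; have dimW : \dim (U + <[w]>) = (\dim U).+1.
    rewrite dimv_disjoint_sum.
      rewrite dim_vline (_ : w != 0) ?addn1 //.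
      by apply: contraNneq wU => ->; rewrite mem0v.
    apply/eqP; rewrite -subv0; apply/subvP=> y; rewrite memv_cap => /andP[yU /vlineP[k yE]].
    have [k0|k0] := eqVneq k 0; first by rewrite yE k0 scale0r mem0v.
    by move: yU; rewrite yE rpredZeq (negPf k0) (negPf wU).
  have : s z \in (s @: (U + <[w]>))%VS by rewrite memv_img.
  rewrite (fixU _ dimW (addvSl _ _)) => /memv_addP[u uU [_ /vlineP[k ->] ->]].
  have /eqP fu : f u == 0 by rewrite f0.
  by rewrite linearD linearZ /= fu add0r memvZ ?memv_line.
have gf x : (f \o s)%VF x \in <[f x]>%VS.
  rewrite comp_lfunE /=; have [xU|xU] := boolP (x \in U); last first.
    by apply: fW => //; rewrite (subvP (addvSr _ _)) ?memv_line.
  suff /eqP -> : f (s x) == 0 by rewrite mem0v.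
  (* Stability of [U] under [s]: if [x] in [U] had its image outside [U], that image would lie in
     every hwise-fixed space over [U], so the quotient would have dimension at most 1. *)
  apply: contraLR dimU => fsx; rewrite -leqNgt.
  have : ({: V} <= U + <[f (s x)]>)%VS.
    apply/subvP=> w _; rewrite -[w](subrK (projv U w)) addrC memv_add ?memv_proj //.
    rewrite -fE; have [|wU] := boolP (w \in U).
      by rewrite -f0 => /eqP ->; rewrite mem0v.
    have /vlineP[k fk] : f (s x) \in <[f w]>%VS.
      by apply: fW => //; rewrite (subvP (addvSl _ _)).
    have k0 : k != 0 by apply: contraNneq fsx => k0; rewrite fk k0 scale0r.
    by apply/vlineP; exists k^-1; rewrite fk scalerA mulVf // scale1r.
  move/dimvS => /leq_trans; apply; apply: leq_trans (dimv_add_leqif _ _).1 _.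
  by rewrite dim_vline -addn1 leq_add2l leq_b1.
have [k kE] := scalar_of_vlines _ _ _ f (f \o s)%VF gf; exists k => x.
by rewrite -f0 linearB linearZ /= subr_eq0 -kE comp_lfunE.
Qed.

(** * The coordinatewise automorphism *)

(* Locked: unification otherwise unfolds an eigenspace against another one, or
   against the axis, and does not return. *)
HB.lock Definition axis (F : finFieldType) (s : 'End('rV[F]_9)) : {vspace 'rV[F]_9} :=
  lker (\1 + s + (s \o s))%VF.
Canonical axis_unlockable := Unlockable axis.unlock.

HB.lock Definition eigen (F : finFieldType) (s : 'End('rV[F]_9)) (k : F) :
  {vspace 'rV[F]_9} := lker (s - k *: \1)%VF.
Canonical eigen_unlockable := Unlockable eigen.unlock.

Section NormalizedPair.
Variables (F L : finFieldType) (iota : {rmorphism F -> L}).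
Variable tau : {rmorphism L -> L}.
Hypothesis tau3 : forall a, tau (tau (tau a)) = a.
Hypothesis tau_iota : forall k, tau (iota k) = iota k.
Hypothesis tau_nontrivial : exists a, tau a != a.
Hypothesis cardL : #|L| = (#|F| ^ 3)%N.

Let V := 'rV[F]_9.
Variables (psi : V -> 'rV[L]_3) (psi' : 'rV[L]_3 -> V) (s : 'End(V)).
Hypothesis psiK : cancel psi psi'.
Hypothesis psi'K : cancel psi' psi.
Hypothesis psiD : {morph psi : x y / x + y}.
Hypothesis psiZ : forall k x, psi (k *: x) = iota k *: psi x.
Hypothesis psi_s : forall x, psi (s x) = map_mx tau (psi x).

Let q := #|F|.
Implicit Types (x y : V) (U l A : {vspace V}) (k : F) (a : L) (v : 'rV[L]_3).

Lemma map_tau_iota m n (y : 'M[F]_(m, n)) :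
  map_mx tau (map_mx iota y) = map_mx iota y.
Proof. by apply/matrixP=> i j; rewrite !mxE. Qed.

Lemma map_tau3 v : map_mx tau (map_mx tau (map_mx tau v)) = v.
Proof. by apply/rowP=> i; rewrite !mxE. Qed.

(** Each entry is fixed by [tau], so [tau_fixed] provides a preimage; the default 0 only makes the
    choice total. *)
Lemma rational_row v : map_mx tau v = v -> exists w : 'rV[F]_3, v = map_mx iota w.
Proof.
move=> tv; exists (\row_i odflt 0 [pick k | v 0 i == iota k]); apply/rowP=> i.
rewrite !mxE; case: pickP => [k /eqP //|no]; exfalso.
have [|k vk] := tau_fixed _ _ _ _ tau_iota tau_nontrivial cardL (v 0 i).
  by rewrite -[in RHS]tv mxE.
by have := no k; rewrite vk eqxx.
Qed.

Lemma psi0 : psi 0 = 0.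
Proof. by rewrite -(scale0r 0) psiZ rmorph0 scale0r. Qed.

Lemma psi_eq0 x : (psi x == 0) = (x == 0).
Proof. by rewrite -[0 in LHS]psi0 (can_eq psiK). Qed.

Lemma s3 x : s (s (s x)) = x.
Proof. by apply: (can_inj psiK); rewrite !psi_s map_tau3. Qed.

Lemma s_eq0 x : (s x == 0) = (x == 0).
Proof.
apply/eqP/eqP => [sx|->]; last exact: linear0.
by rewrite -(s3 x) sx !linear0.
Qed.

(** * The axis and the eigenspaces *)

Definition orbit_sum : 'End(V) := (\1 + s + (s \o s))%VF.
Local Notation axis := (axis F s).
Local Notation eigen := (eigen F s).

Lemma mem_axis x : (x \in axis) = (x + s x + s (s x) == 0).
Proof. by rewrite unlock memv_ker !add_lfunE comp_lfunE id_lfunE. Qed.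

Lemma mem_eigen k x : (x \in eigen k) = (s x == k *: x).
Proof.
by rewrite unlock memv_ker add_lfunE opp_lfunE scale_lfunE id_lfunE subr_eq0.
Qed.

Lemma dim_axis_limg : (\dim axis + \dim (limg orbit_sum) = 9)%N.
Proof.
have := limg_ker_dim orbit_sum fullv.
by rewrite capfv dimvf /dim /= mul1n axis.unlock.
Qed.

Lemma dim_eigen1_limg : (\dim (eigen 1%R) + \dim (limg (s - \1%VF)%R) = 9)%N.
Proof.
have := limg_ker_dim (s - \1)%VF fullv.
by rewrite capfv dimvf /dim /= mul1n eigen.unlock scale1r.
Qed.

Lemma axisE x : x \in axis -> s (s x) = - x - s x.
Proof.
by rewrite mem_axis addrC addr_eq0 opprD => /eqP.
Qed.

Lemma eigen_cube k x : x \in eigen k -> x != 0 -> k ^+ 3 = 1.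
Proof.
rewrite mem_eigen => /eqP sx x0; have := s3 x.
rewrite sx linearZ /= sx linearZ /= linearZ /= sx !scalerA.
move/eqP; rewrite -subr_eq0 -{2}(scale1r x) -scalerBl scaler_eq0 (negPf x0) orbF.
by rewrite subr_eq0 => /eqP <-; ring.
Qed.

Lemma eigen_inj k k' x : x \in eigen k -> x \in eigen k' -> x != 0 -> k = k'.
Proof.
rewrite !mem_eigen => /eqP -> /eqP/eqP; rewrite -subr_eq0 -scalerBl scaler_eq0 => /orP[].
  by rewrite subr_eq0 => /eqP.
by move=> ->.
Qed.

Lemma fixed_eigen x : reflect (exists k, x \in eigen k) (s x \in <[x]>%VS).
Proof.
apply: (iffP idP) => [/vlineP[k sx]|[k]]; first by exists k; rewrite mem_eigen sx.
by rewrite mem_eigen => /eqP sx; apply/vlineP; exists k.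
Qed.

(** On an eigenvector the operator 1 + s + s^2 is multiplication by 1 + k + k^2. *)
Lemma eigen_axis k x : x \in eigen k -> x != 0 ->
  (x \in axis) = (k \in prim_cube_roots F).
Proof.
rewrite mem_eigen => /eqP sx x0; rewrite mem_axis inE sx linearZ /= sx scalerA.
rewrite -{1}(scale1r x) -!scalerDl scaler_eq0 (negPf x0) orbF.
by congr (_ == _); ring.
Qed.

(** The norm of [iota k] is [k ^+ 3 = 1], so Hilbert 90 gives [a] with [tau a = iota k * a]. In
    coordinates the eigenspace then consists of the products of [a] with the rows over [F]. *)
Lemma dim_eigen k : k ^+ 3 = 1 -> \dim (eigen k) = 3%N.
Proof.
move=> k3; have k0 : iota k != 0.
  by rewrite fmorph_eq0; apply: contra_eq_neq k3 => ->; rewrite expr0n eq_sym oner_neq0.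
have [|a a0 ta] := hilbert90 _ _ tau3 tau_nontrivial (iota k)^-1.
  rewrite !fmorphV !tau_iota -!invfM -!rmorphM (_ : k * k * k = k ^+ 3); last by ring.
  by rewrite k3 rmorph1 invr1.
have {}ta : tau a = iota k * a by rewrite -[in RHS]ta mulVKf.
apply: dim_vspace_card; rewrite -[(_ ^ 3)%N]mul1n.
have -> : (1 * #|F| ^ 3 = #|{: 'rV[F]_3}|)%N by rewrite card_mx mul1n.
rewrite -cardsT.
pose f (y : 'rV[F]_3) := psi' (a *: map_mx iota y).
have finj : injective f.
  move=> y z /(can_inj psi'K)/(scalerI a0) /rowP E; apply/rowP=> i.
  by have := E i; rewrite !mxE => /fmorph_inj.
rewrite -(card_imset _ finj); apply: eq_card => x; rewrite inE mem_eigen.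
apply/eqP/imsetP => [sx|[y _ ->]]; last first.
  by apply: (can_inj psiK); rewrite psi_s psiZ /f psi'K map_mxZ map_tau_iota /= ta scalerA.
have [|y xy] := rational_row (a^-1 *: psi x).
  rewrite map_mxZ -psi_s sx psiZ fmorphV ta scalerA; congr (_ *: _).
  by field; rewrite a0.
by exists y => //; rewrite /f -xy scalerA mulfV // scale1r psiK.
Qed.

(** In coordinates [orbit_sum] is the entrywise trace. Multiplying a fixed vector by an element of
    trace 1 gives a preimage of it, so the image is [eigen 1], of dimension 3, and the kernel has
    dimension 9 - 3. *)
Lemma dim_axis : \dim axis = 6%N.
Proof.
suff imE : limg orbit_sum = eigen 1.
  by have := dim_axis_limg; rewrite imE (dim_eigen _ (expr1n _ _)) => /(@addIn 3 _ 6).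
apply/vspaceP=> x; rewrite mem_eigen scale1r; apply/memv_imgP/eqP => [[y _ ->]|sx].
  by rewrite !add_lfunE comp_lfunE id_lfunE !linearD /= s3 addrC addrA.
have [a a1] := trace_onto _ _ _ _ tau3 tau_iota tau_nontrivial cardL.
have [|y xy] := rational_row (psi x); first by rewrite -psi_s sx.
exists (psi' (a *: psi x)); first exact: memvf.
apply: (can_inj psiK); rewrite !add_lfunE comp_lfunE id_lfunE.
rewrite !psiD !psi_s psi'K !map_mxZ -!psi_s !sx -!scalerDl.
by rewrite -/(trace _ tau a) a1 scale1r.
Qed.

(** One inclusion is (1 + s + s^2)(s - 1) = s^3 - 1 = 0; the dimensions are both 6. In this form the
    axis can be compared with a hwise-fixed 5-space. *)
Lemma axis_limg : axis = limg (s - \1%VF)%R.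
Proof.
apply/esym/eqP; rewrite eqEdim; apply/andP; split.
  apply/subvP=> _ /memv_imgP[x _ ->]; rewrite mem_axis add_lfunE opp_lfunE id_lfunE.
  by rewrite !linearB /= s3 [s x - x + _]addrC !addrA !subrK subrr.
have := dim_eigen1_limg.
by rewrite dim_axis (dim_eigen _ (expr1n _ _)) => /(@addnI 3 _ 6) ->.
Qed.

(** * Vectors of Type I and Type II on the axis *)

Definition pointI x := psi (s x) \in <[psi x]>%VS.

(** If [tau] multiplies the row by a scalar, dividing the row by a nonzero entry makes all entries
    fixed by [tau], hence rational. *)
Lemma pointIP x : reflect (exists a (w : 'rV[F]_3), psi x = a *: map_mx iota w) (pointI x).
Proof.
apply: (iffP idP) => [/vlineP[k sx]|[a [y xy]]]; last first.
  apply/vlineP.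
  have [a0|a0] := eqVneq a 0.
    by exists 0; rewrite psi_s xy a0 !scale0r map_mx0.
  by exists (tau a / a); rewrite psi_s xy map_mxZ map_tau_iota scalerA divfK.
have [/eqP|] := eqVneq x 0.
  by rewrite -psi_eq0 => /eqP ->; exists 0, 0; rewrite scale0r.
rewrite -psi_eq0 => /rV0Pn[i xi0]; have txi : tau (psi x 0 i) = k * psi x 0 i.
  by move/rowP/(_ i): sx; rewrite psi_s !mxE.
have k0 : k != 0.
  apply: contraNneq xi0 => k0; move/eqP: txi.
  by rewrite k0 mul0r fmorph_eq0.
have [|y xy] := rational_row ((psi x 0 i)^-1 *: psi x).
  rewrite map_mxZ -psi_s sx fmorphV txi scalerA; congr (_ *: _).
  by field; rewrite xi0 k0.
by exists (psi x 0 i), y; rewrite -xy scalerA mulfV // scale1r.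
Qed.

Lemma fixed_pointI x : s x \in <[x]>%VS -> pointI x.
Proof. by case/vlineP=> k sx; apply/vlineP; exists (iota k); rewrite sx psiZ. Qed.

Lemma rational_multiple_axis x a (w : 'rV[F]_3) :
  psi x = a *: map_mx iota w -> w != 0 -> (x \in axis) = (trace L tau a == 0).
Proof.
move=> xw w0; rewrite mem_axis -psi_eq0 !psiD !psi_s xw !map_mxZ !map_tau_iota.
rewrite -!scalerDl scaler_eq0 -[_ + _ + _]/(trace L tau a).
suff -> : (map_mx iota w == 0) = false by rewrite orbF.
apply: contraNF w0 => /eqP/rowP E; apply/eqP/rowP=> i.
by apply: (fmorph_inj iota); have := E i; rewrite !mxE rmorph0.
Qed.

(** These vectors are the products of a nonzero [a] of trace 0 and a nonzero rational row [w]. The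
    pairs giving the same product are [(iota k * a, k^-1 *: w)] for nonzero [k] in [F]. *)
Lemma card_pointI :
  (#|[set x : V in axis | (x != 0%R) && pointI x]| * (q - 1) = (q ^ 2 - 1) * (q ^ 3 - 1))%N.
Proof.
pose DA := [set a : L | trace L tau a == 0] :\ 0.
pose DW := [set~ 0] : {set 'rV[F]_3}.
have cDA : #|DA| = (q ^ 2 - 1)%N.
  have t0 : trace L tau 0 = 0 by rewrite /trace !rmorph0 !addr0.
  have := cardsD1 0 [set a : L | trace L tau a == 0].
  by rewrite (card_trace0 F L iota tau) // inE t0 eqxx => ->; rewrite add1n subn1.
have cDW : #|DW| = (q ^ 3 - 1)%N by rewrite cardsC1 card_mx mul1n subn1.
pose f (u : L * 'rV[F]_3) : V := psi' (u.1 *: map_mx iota u.2).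
have iota_row0 (w : 'rV[F]_3) : (map_mx iota w == 0) = (w == 0).
  apply/eqP/eqP => [/rowP E|->]; last exact: map_mx0.
  by apply/rowP=> i; apply: (fmorph_inj iota); have := E i; rewrite !mxE rmorph0.
have := @card_fibers _ _ f (setX DA DW) (q - 1)%N.
rewrite cardsX cDA cDW => ->; first congr (#|pred_of_set _| * _)%N.
  apply/setP=> x; rewrite inE; apply/and3P/imsetP => [[xa x0 /pointIP[a [w xw]]]|].
    have : psi x != 0 by rewrite psi_eq0.
    rewrite xw scaler_eq0 negb_or iota_row0 => /andP[a0 w0].
    exists (a, w); last by rewrite /f /= -xw psiK.
    by rewrite !inE /= a0 w0 -(rational_multiple_axis _ _ _ xw w0) xa.
  case=> -[a w]; rewrite !inE /= => /andP[/andP[a0 ta] w0] ->.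
  have fE : psi (f (a, w)) = a *: map_mx iota w by rewrite psi'K.
  split; first by rewrite (rational_multiple_axis _ _ _ fE w0).
    by rewrite -psi_eq0 fE scaler_eq0 iota_row0 negb_or a0.
  by apply/pointIP; exists a, w.
move=> [a w]; rewrite !inE /= => /andP[/andP[a0 ta] w0].
pose g k := (iota k * a, k^-1 *: w).
have ginj : injective g.
  by move=> k k' [/(mulIf a0)/fmorph_inj].
have -> : (q - 1)%N = #|[set~ (0 : F)]| by rewrite cardsC1 subn1.
rewrite -(card_imset _ ginj); apply: eq_card => -[b y]; rewrite !inE /=.
apply/andP/imsetP => [[/andP[/andP[b0 tb] y0] /eqP]|[k]].
  move/(can_inj psi'K) => /= E; have /rV0Pn[i yi] := y0.
  have Ei : b * iota (y 0 i) = a * iota (w 0 i) by move/rowP/(_ i): E; rewrite !mxE.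
  have iy : iota (y 0 i) != 0 by rewrite fmorph_eq0.
  have wi : w 0 i != 0.
    rewrite -(fmorph_eq0 iota); apply: contraNneq b0 => wi; move/eqP: Ei.
    by rewrite wi mulr0 mulf_eq0 (negPf iy) orbF.
  (* Two factorizations of one row agree at entry [i], where [y] does not vanish; this entry
     determines the scalar between them. *)
  exists (w 0 i / y 0 i); first by rewrite !inE mulf_neq0 ?invr_eq0.
  have bE : b = iota (w 0 i / y 0 i) * a.
    by apply: (mulIf iy); rewrite Ei fmorph_div; field.
  rewrite /g -bE; congr (_, _); apply: (scalerI (_ : w 0 i / y 0 i != 0)).
    by rewrite mulf_neq0 ?invr_eq0.
  rewrite scalerA mulfV ?mulf_neq0 ?invr_eq0 // scale1r.
  apply/rowP=> j; apply: (fmorph_inj iota); apply: (mulfI a0).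
  move/rowP/(_ j): E; rewrite !mxE bE => <-.
  by rewrite rmorphM; ring.
rewrite !inE => k0 [-> ->]; have ik : iota k != 0 by rewrite fmorph_eq0.
split; last first.
  rewrite /f /= map_mxZ scalerA fmorphV; apply/eqP; congr (psi' (_ *: _)).
  by field.
rewrite mulf_neq0 // scaler_eq0 negb_or invr_eq0 k0 w0 mulrC trace_iota //.
by rewrite (eqP ta) mul0r eqxx.
Qed.

(** Eigenspaces for distinct eigenvalues share only 0, and those inside the axis belong to
    [prim_cube_roots]. *)
Lemma card_fixed_vectors :
  #|[set x : V in axis | (x != 0%R) && (s x \in <[x]>%VS)]|
    = (#|prim_cube_roots F| * (q ^ 3 - 1))%N.
Proof.
rewrite -(@card_bigcup_uniform _ _ _ (fun k => [set x : V in eigen k | x != 0])).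
- apply: eq_card => x; rewrite inE; apply/and3P/bigcupP => [[xa x0 /fixed_eigen[k xk]]|].
    by exists k; [rewrite -(eigen_axis _ _ xk x0) | rewrite inE xk].
  case=> k kr; rewrite inE => /andP[xk x0]; split=> //; last by apply/fixed_eigen; exists k.
  by rewrite (eigen_axis _ _ xk x0).
- by move=> k; rewrite inE => /eqP/prim_cube_rootE k3; rewrite card_mem_vspaceD0 dim_eigen.
- move=> k k' x _ _; rewrite inE => /andP[xk x0]; rewrite inE => /andP[xk' _].
  exact: eigen_inj xk xk' x0.
Qed.

(** Eigenvectors are of Type I, so they split off from the Type I vectors. The count is a sum in
    order to avoid truncated subtraction. *)
Lemma card_axis_pointI :
  (#|[set x : V in axis | (s x \notin <[x]>%VS) && pointI x]|
     + #|[set x : V in axis | (x != 0%R) && (s x \in <[x]>%VS)]|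
   = #|[set x : V in axis | (x != 0%R) && pointI x]|)%N.
Proof.
rewrite addnC -(cardsID [set x : V | s x \in <[x]>%VS]
  [set x : V in axis | (x != 0) && pointI x]).
congr (_ + _)%N; apply: eq_card => x; rewrite !inE.
  case fx: (s x \in _); rewrite ?andbF ?andbT //.
  by rewrite fixed_pointI ?fx ?andbT.
case fx: (s x \in _); rewrite ?andbF //=.
have -> // : x != 0; by apply: contraFneq fx => ->; rewrite linear0 mem0v.
Qed.

Lemma card_axis_pointII :
  (#|[set x : V in axis | (s x \notin <[x]>%VS) && ~~ pointI x]|
     + #|[set x : V in axis | (x != 0%R) && pointI x]| = q ^ 6 - 1)%N.
Proof.
rewrite [RHS](_ : _ = #|[set x : V in axis | x != 0]|); last first.
  by rewrite card_mem_vspaceD0 dim_axis.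
rewrite addnC.
rewrite -(cardsID [set x : V | pointI x] [set x : V in axis | x != 0]).
congr (_ + _)%N; apply: eq_card => x; rewrite !inE ?andbA //.
case Ix: (pointI x); rewrite ?andbF //= !andbT; congr (_ && _).
have nfx : s x \notin <[x]>%VS by apply: contraFN Ix => /fixed_pointI.
by rewrite nfx; apply/esym; apply: contraNneq nfx => ->; rewrite linear0 mem0v.
Qed.

(** * Lines spanned by an orbit *)

Definition orbit_line x : {vspace V} := line_thru F 9 x (s x).

Lemma nonfixed_neq0 x : s x \notin <[x]>%VS -> x != 0.
Proof. by apply: contraNneq => ->; rewrite linear0 mem0v. Qed.

Lemma dim_orbit_line x : s x \notin <[x]>%VS -> \dim (orbit_line x) = 2%N.
Proof. by move=> nfx; rewrite dim_line_thru ?nonfixed_neq0. Qed.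

(** On the axis [s (s x) = - x - s x], which is again in the span of [x] and [s x]. *)
Lemma orbit_line_stable x y :
  x \in axis -> y \in orbit_line x -> s y \in orbit_line x.
Proof.
move=> xa /mem_line_thruP[a [b ->]]; rewrite linearD !linearZ /= axisE //.
apply/mem_line_thruP; exists (- b), (a - b).
by rewrite scalerBr scalerN scalerBl scaleNr addrCA.
Qed.

Lemma orbit_line_axis x : x \in axis -> (orbit_line x <= axis)%VS.
Proof.
by move=> xa; rewrite line_thru_sub xa mem_axis s3 addrC addrA -mem_axis.
Qed.

(** The line contains [y] and [s y], which are independent. Hence the orbit lines partition the
    vectors of the axis that are not eigenvectors. *)
Lemma orbit_line_eq x y : x \in axis -> y \in orbit_line x ->
  s x \notin <[x]>%VS -> s y \notin <[y]>%VS -> orbit_line y = orbit_line x.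
Proof.
move=> xa yx nfx nfy; apply: line_thru_eq; rewrite ?nonfixed_neq0 //.
  exact: dim_orbit_line.
exact: orbit_line_stable.
Qed.

(** On this line [s] has characteristic polynomial X^2 + X + 1, and each root [k] in [F] has exactly
    one eigenpoint there, spanned by [x - k *: s x]. The remaining nonzero vectors are moved. *)
Lemma card_orbit_line x : x \in axis -> s x \notin <[x]>%VS ->
  (#|[set y : V in orbit_line x | s y \notin <[y]>%VS]|
     + #|prim_cube_roots F| * (q - 1) = q ^ 2 - 1)%N.
Proof.
move=> xa nfx; rewrite [RHS](_ : _ = #|[set y : V in orbit_line x | y != 0]|); last first.
  by rewrite card_mem_vspaceD0 dim_orbit_line.
rewrite addnC -(cardsID [set y : V | s y \in <[y]>%VS]
  [set y : V in orbit_line x | y != 0]).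
congr (_ + _)%N; last first.
  apply: eq_card => y; rewrite !inE andbC; case fy: (s y \in _) => //=.
  by rewrite nonfixed_neq0 ?fy ?andbT.
have -> : (q - 1)%N = #|[set~ (0 : F)]| by rewrite cardsC1 subn1.
rewrite -cardsX; pose f (u : F * F) : V := u.2 *: (x - u.1 *: s x).
have lin0 (a b : F) : a *: x + b *: s x = 0 -> a = 0 /\ b = 0.
  have [-> |b0 /eqP] := eqVneq b 0.
    rewrite scale0r addr0 => /eqP; rewrite scaler_eq0 (negPf (nonfixed_neq0 _ nfx)) orbF.
    by move/eqP.
  rewrite addrC addr_eq0 => /eqP/(congr1 ( *:%R b^-1)).
  rewrite scalerA mulVf // scale1r => sx; case/negP: nfx.
  by rewrite sx memvZ // rpredN memvZ // memv_line.
have finj : {in setX (prim_cube_roots F) [set~ 0] &, injective f}.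
  move=> [k c] [k' c']; rewrite !inE /= => /andP[_ c0] /andP[_ c0'] E.
  have [|/eqP] := lin0 (c - c') (c' * k' - c * k).
    rewrite -[RHS](subrr (f (k, c))) {2}E /f /=.
    by apply/rowP=> i; rewrite !mxE; ring.
  rewrite subr_eq0 => /eqP -> /eqP; rewrite -mulrBr mulf_eq0 (negPf c0') subr_eq0 /=.
  by move/eqP=> ->.
rewrite -(card_in_imset finj); apply/esym/eq_card => y; rewrite !inE.
apply/andP/imsetP => [[/andP[/mem_line_thruP[a [b yE]] y0]]|[[k c]]].
  case/fixed_eigen=> k; have kr : y \in axis.
    by apply: (subvP (orbit_line_axis _ xa)); apply/mem_line_thruP; exists a, b.
  move=> yk; rewrite (eigen_axis _ _ yk y0) in kr.
  move: yk; rewrite mem_eigen {1 2}yE linearD !linearZ /= axisE // => /eqP E.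
  (* The equation [s y = k *: y] is read off in the basis [x], [s x]; its first coordinate gives
     [b = - (k * a)]. *)
  have [E1 E2] : - b - k * a = 0 /\ a - b - k * b = 0.
    apply: lin0; move/eqP: E; rewrite -subr_eq0 => /eqP <-.
    by apply/rowP=> i; rewrite !mxE; ring.
  have a0 : a != 0.
    apply: contraNneq y0 => a0; move: E1; rewrite a0 mulr0 subr0 => /eqP.
    by rewrite oppr_eq0 yE a0 scale0r add0r => /eqP ->; rewrite scale0r.
  exists (k, a); first by rewrite !inE a0 andbT; rewrite inE in kr.
  rewrite /f /= yE scalerBr scalerA -scaleNr; congr (_ + _ *: _).
  by apply/eqP; rewrite eq_sym -subr_eq0 -[X in _ == X]E1; apply/eqP; ring.
rewrite !inE /= => /andP[kr c0] ->.
have fy : f (k, c) \in eigen k.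
  rewrite mem_eigen linearZ linearB /= linearZ /= axisE //.
  apply/eqP/rowP=> i; rewrite !mxE /=; apply/eqP; rewrite -subr_eq0; apply/eqP.
  by rewrite -[RHS](mulr0 (c * s x 0 i)) -(eqP kr); ring.
split; last by apply/fixed_eigen; exists k.
apply/andP; split.
  apply/mem_line_thruP; exists c, (- (c * k)).
  by rewrite /f /= scalerBr scalerA scaleNr.
rewrite scaler_eq0 negb_or c0 /=; apply/eqP=> E.
have [|/eqP] := lin0 1 (- k); first by rewrite scale1r scaleNr.
by rewrite oner_eq0.
Qed.

(** * Points of one kind and the fixed lines through them *)

Section FixedLines.
Variables (P : pred {vspace V}) (p : pred V).
Hypothesis P_point : forall A, P A -> is_point A.
Hypothesis P_vline : forall x, x \in axis -> x != 0 ->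
  P <[x]>%VS = (s x \notin <[x]>%VS) && p x.
Hypothesis p_orbit_line : forall x y, x \in axis -> s x \notin <[x]>%VS ->
  y \in orbit_line x -> s y \notin <[y]>%VS -> p x -> p y.

Lemma card_P_points :
  (#|[set A | (A <= axis)%VS && P A]| * (q - 1)
     = #|[set x : V in axis | (s x \notin <[x]>%VS) && p x]|)%N.
Proof.
have -> : [set A | (A <= axis)%VS && P A]
    = [set A | is_point A && ((A <= axis)%VS && P A)].
  apply/setP=> A; rewrite !inE; case PA: (P A); rewrite ?andbF // !andbT.
  by rewrite P_point.
rewrite card_points; apply: eq_card => x; rewrite !inE -memvE.
case xa: (x \in axis); rewrite ?andbF //=.
case: (eqVneq x 0) => [-> |x0] /=; first by rewrite linear0 mem0v.
by rewrite P_vline.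
Qed.

(** A fixed line through the [P]-point [<[x]>] contains [x] and [s x], so it is [orbit_line x]. The
    fibre of [orbit_line] over it consists of all its non-eigenvectors, because each of them
    satisfies [p] again. *)
Lemma card_fixed_P_lines :
  (#|[set l | (l <= axis)%VS && [&& is_line l, (s @: l)%VS == l &
        [exists A, P A && (A <= l)%VS]]]| * (q ^ 2 - 1 - #|prim_cube_roots F| * (q - 1))
     = #|[set x : V in axis | (s x \notin <[x]>%VS) && p x]|)%N.
Proof.
rewrite [RHS](@card_fibers _ _ orbit_line _ (q ^ 2 - 1 - #|prim_cube_roots F| * (q - 1))%N).
  congr (#|pred_of_set _| * _)%N; apply/setP=> l; rewrite inE.
  apply/and4P/imsetP => [[la /eqP dl /eqP sl /existsP[A /andP[PA]]]|[x]].
    have /is_pointP[x x0 AE] := P_point _ PA; rewrite AE -memvE => xl.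
    have xa := subvP la _ xl; move: PA; rewrite AE P_vline // => /andP[nfx px].
    exists x; first by rewrite inE xa nfx.
    by apply/esym/line_thru_eq => //; rewrite -sl memv_img.
  rewrite inE => /and3P[xa nfx px] ->.
  have sub : (s @: orbit_line x <= orbit_line x)%VS.
    by apply/subvP=> _ /memv_imgP[y yl ->]; apply: orbit_line_stable.
  split; first exact: orbit_line_axis.
  - by rewrite /is_line /kspace dim_orbit_line.
  - have k0 : (orbit_line x :&: lker s)%VS = 0%VS.
      apply/eqP; rewrite -subv0; apply/subvP=> y; rewrite memv_cap memv_ker memv0 s_eq0.
      by case/andP.
    by rewrite eqEdim sub limg_dim_eq ?leqnn.
  - apply/existsP; exists <[x]>%VS; rewrite P_vline ?nonfixed_neq0 // nfx px.
    by rewrite -memvE mem_line_thrul.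
move=> x; rewrite inE => /and3P[xa nfx px].
rewrite -(card_orbit_line x) // addnK; apply: eq_card => y; rewrite !inE.
apply/andP/andP => [[/and3P[ya nfy py] /eqP <-]|[yl nfy]].
  by rewrite mem_line_thrul.
rewrite (subvP (orbit_line_axis _ xa)) // nfy (p_orbit_line x) //.
by rewrite (orbit_line_eq x).
Qed.

End FixedLines.

(** Both [psi x] and its image under [tau] are [L]-multiples of one rational row, hence so are all
    their combinations. *)
Lemma pointI_orbit_line x y : pointI x -> y \in orbit_line x -> pointI y.
Proof.
case/pointIP=> a [w xw] /mem_line_thruP[b [c ->]]; apply/pointIP.
exists (iota b * a + iota c * tau a), w.
by rewrite psiD !psiZ psi_s xw map_mxZ map_tau_iota !scalerA scalerDl.
Qed.

(** As [x] lies on the orbit line of [y], a Type I vector [y] would make [x] of Type I. *)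
Lemma pointII_orbit_line x y : x \in axis -> s x \notin <[x]>%VS ->
  y \in orbit_line x -> s y \notin <[y]>%VS -> ~~ pointI x -> ~~ pointI y.
Proof.
move=> xa nfx yx nfy; apply: contra => Iy; apply: pointI_orbit_line Iy _.
by rewrite (orbit_line_eq x) ?mem_line_thrul.
Qed.

(** * Pointwise fixed lines and planes *)

Section PointwiseFixed.
Variable sigma : {perm {vspace V}}.
Hypothesis sigmaE : forall U, sigma U = (s @: U)%VS.

Lemma fixed_pointE x : x != 0 -> (sigma <[x]>%VS == <[x]>%VS) = (s x \in <[x]>%VS).
Proof. by move=> x0; rewrite sigmaE limg_line vline_eqE // s_eq0. Qed.

(** A linear map fixing every point of [U] is a scalar on [U], and s^3 = 1 makes the scalar a cube
    root of unity. Composing with [projv U] gives maps on the whole space, to which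
    [scalar_of_vlines] applies. *)
Lemma ptwise_fixedP U : U != 0%VS ->
  reflect (exists2 k, k ^+ 3 = 1 & (U <= eigen k)%VS) (ptwise_fixed sigma U).
Proof.
move=> U0; apply: (iffP forallP) => [H|[k k3 Uk] A].
  have [|k kE] := scalar_of_vlines _ _ _ (projv U) (s \o projv U)%VF.
    move=> x; rewrite comp_lfunE /=; set y := projv U x.
    have [-> |y0] := eqVneq y 0; first by rewrite linear0 mem0v.
    rewrite -fixed_pointE //; have := H <[y]>%VS; rewrite -memvE memv_proj andbT.
    by move/implyP; apply; apply/is_pointP; exists y.
  have Uk : (U <= eigen k)%VS.
    apply/subvP=> x xU; rewrite mem_eigen; have := kE x.
    by rewrite comp_lfunE /= projv_id // => ->.
  exists k => //; apply: (eigen_cube _ (vpick U)); last by rewrite vpick0.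
  exact: (subvP Uk _ (memv_pick U)).
apply/implyP=> /andP[/is_pointP[x x0 ->]]; rewrite -memvE => xU.
by rewrite fixed_pointE //; apply/fixed_eigen; exists k; apply: (subvP Uk).
Qed.

Lemma eigen_sub_axis k U : (U <= eigen k)%VS -> U != 0%VS ->
  (U <= axis)%VS = (k \in prim_cube_roots F).
Proof.
move=> Uk U0; apply/idP/idP => [Ua|kr].
  rewrite -(eigen_axis _ (vpick U)) ?vpick0 ?(subvP Ua) ?memv_pick //.
  by rewrite (subvP Uk) ?memv_pick.
apply/subvP=> x xU; have [-> |x0] := eqVneq x 0; first exact: mem0v.
by rewrite (eigen_axis k) // (subvP Uk).
Qed.

Lemma kspace_neq0 d U : kspace d U -> U != 0%VS.
Proof. by rewrite -dimv_eq0 => /eqP ->. Qed.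

(** A pointwise fixed plane has the dimension of the eigenspace that contains it. *)
Lemma ptwise_fixed_plane_eigen U :
  reflect (exists2 k, k ^+ 3 = 1 & U = eigen k) (ptwise_fixed_plane sigma U).
Proof.
apply: (iffP andP) => [[dU /(ptwise_fixedP _ (kspace_neq0 _ _ dU))[k k3 Uk]]|[k k3 ->]].
  by exists k => //; apply/eqP; rewrite eqEdim Uk dim_eigen // (eqP dU).
have dk : is_plane (eigen k) by rewrite /is_plane /kspace dim_eigen.
by split=> //; apply/(ptwise_fixedP _ (kspace_neq0 _ _ dk)); exists k.
Qed.

Lemma eigen_neq0 k : k ^+ 3 = 1 -> eigen k != 0%VS.
Proof. by move=> k3; rewrite -dimv_eq0 dim_eigen. Qed.

Lemma card_ptwise_fixed_lines :
  #|[set l | (l <= axis)%VS && ptwise_fixed_line sigma l]|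
    = (#|prim_cube_roots F| * (q ^ 2 + q + 1))%N.
Proof.
rewrite -(@card_bigcup_uniform _ _ _ (fun k => [set l | (l <= eigen k)%VS && is_line l])).
- apply: eq_card => l; rewrite inE; apply/and3P/bigcupP => [[la dl]|[k kr]].
    have l0 := kspace_neq0 _ _ dl; case/(ptwise_fixedP _ l0) => k k3 lk.
    by exists k; rewrite ?inE ?lk //; rewrite (eigen_sub_axis k) // inE in la.
  rewrite inE => /andP[lk dl]; have l0 := kspace_neq0 _ _ dl.
  split; rewrite ?(eigen_sub_axis k) //; apply/(ptwise_fixedP _ l0).
  by exists k => //; apply: prim_cube_rootE; apply/eqP; rewrite inE in kr.
- by move=> k; rewrite inE => /eqP/prim_cube_rootE k3; rewrite card_lines ?dim_eigen.
- move=> k k' l _ _; rewrite !inE => /andP[lk dl] /andP[lk' _].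
  have l0 := kspace_neq0 _ _ dl.
  apply: (eigen_inj _ _ (vpick l)); rewrite ?vpick0 //.
    exact: (subvP lk _ (memv_pick l)).
  exact: (subvP lk' _ (memv_pick l)).
Qed.

Lemma eigen_fun_inj : {in cube_roots F &, injective eigen}.
Proof.
move=> k k'; rewrite !inE => /eqP k3 _ E; have U0 := eigen_neq0 _ k3.
apply: (eigen_inj _ _ (vpick (eigen k))); rewrite ?vpick0 // ?memv_pick //.
by rewrite -E memv_pick.
Qed.

Lemma ptwise_fixed_planes :
  [set U | ptwise_fixed_plane sigma U] = eigen @: cube_roots F.
Proof.
apply/setP=> U; rewrite inE; apply/ptwise_fixed_plane_eigen/imsetP => -[k k3 ->].
  by exists k; rewrite ?inE ?k3.
by exists k => //; apply/eqP; rewrite inE in k3.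
Qed.

Lemma prim_cube_roots_sub : prim_cube_roots F \subset cube_roots F.
Proof. by rewrite cube_roots_cons subsetUr. Qed.

Lemma card_ptwise_fixed_planes_axis :
  #|[set U | (U <= axis)%VS && ptwise_fixed_plane sigma U]| = #|prim_cube_roots F|.
Proof.
rewrite -(card_in_imset (sub_in2 (subsetP prim_cube_roots_sub) eigen_fun_inj)).
apply: eq_card => U; rewrite inE.
apply/andP/imsetP => [[Ua /ptwise_fixed_plane_eigen]|[k kr ->]].
  case=> k k3 UE; exists k => //; rewrite UE in Ua.
  by rewrite -(eigen_sub_axis k (eigen k)) ?subvv ?eigen_neq0.
have k3 : k ^+ 3 = 1 by apply: prim_cube_rootE; apply/eqP; rewrite inE in kr.
rewrite (eigen_sub_axis k) ?subvv ?eigen_neq0 //; split=> //.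
by apply/ptwise_fixed_plane_eigen; exists k.
Qed.

Lemma card_ptwise_fixed_planes_not_axis :
  (#|[set U | ptwise_fixed_plane sigma U && ~~ (U <= axis)%VS]|
     + #|prim_cube_roots F| = #|cube_roots F|)%N.
Proof.
rewrite -(card_in_imset eigen_fun_inj) -ptwise_fixed_planes.
rewrite -(cardsID [set U : {vspace V} | (U <= axis)%VS]
  [set U | ptwise_fixed_plane sigma U]).
rewrite -card_ptwise_fixed_planes_axis addnC; congr (_ + _)%N; apply: eq_card => U.
  by rewrite !inE andbC.
by rewrite !inE andbC.
Qed.

(** Such a plane is an eigenspace with 1 + k + k^2 nonzero, so 1 + s + s^2 kills none of its nonzero
    vectors. *)
Lemma ptwise_fixed_plane_disjoint U :
  ptwise_fixed_plane sigma U -> ~~ (U <= axis)%VS -> (U :&: axis = 0)%VS.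
Proof.
case/ptwise_fixed_plane_eigen=> k k3 ->; rewrite (eigen_sub_axis k) ?subvv ?eigen_neq0 //.
move=> kr; apply/eqP; rewrite -subv0; apply/subvP=> x; rewrite memv_cap memv0.
by case/andP=> xk; apply: contraLR => x0; rewrite (eigen_axis k).
Qed.

End PointwiseFixed.

End NormalizedPair.

(** * Reduction to the coordinatewise automorphism *)

(** An argument as in the fundamental theorem of projective geometry. The fixed unit vectors make
    [t] act entry by entry, the fixed all-one vector makes the entry maps one additive map [g], and
    dividing [g] by [c = g 1] gives a field morphism. *)
Lemma semilinear_of_subplane (F L : finFieldType) (iota : {rmorphism F -> L})
    (t : 'rV[L]_3 -> 'rV[L]_3) :
    {morph t : v w / v + w} -> (forall v, t v = 0 -> v = 0) ->
    (forall a v, t (a *: v) \in <[t v]>%VS) ->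
    (forall k v, t (iota k *: v) = iota k *: t v) ->
    (forall w : 'rV[F]_3, t (map_mx iota w) \in <[map_mx iota w]>%VS) ->
  exists c (tau : {rmorphism L -> L}),
    [/\ c != 0, forall v, t v = c *: map_mx tau v & forall k, tau (iota k) = iota k].
Proof.
move=> tD t_inj t_line tZ t_sub.
have t0 : t 0 = 0 by have := tZ 0 0; rewrite rmorph0 !scale0r.
have t_delta a j : exists k, t (a *: delta_mx 0 j) = k *: delta_mx 0 j.
  have /vlineP[k ->] := t_line a (delta_mx 0 j).
  have /vlineP[l] := t_sub (delta_mx 0 j); rewrite map_delta_mx => ->.
  by exists (k * l); rewrite scalerA.
pose h j a := t (a *: delta_mx 0 j) 0 j.
have tE v i : t v 0 i = h i (v 0 i).
  rewrite {1}(row_sum_delta v) (big_morph t tD t0) summxE (bigD1 i) //= big1 ?addr0 //.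
  move=> j ji; have [k ->] := t_delta (v 0 j) j; rewrite !mxE /=.
  by rewrite eq_sym (negPf ji) mulr0.
pose c := h 0 1; have one_iota : map_mx iota (const_mx 1) = const_mx 1 :> 'rV_3.
  by rewrite map_const_mx rmorph1.
have t1 : t (const_mx 1) = c *: const_mx 1.
  have /vlineP[k] := t_sub (const_mx 1); rewrite one_iota => t1.
  by have := tE (const_mx 1) 0; rewrite t1 !mxE mulr1 /c => ->.
have hE i a : h i a = h 0 a.
  have /vlineP[k] := t_line a (const_mx 1); rewrite t1 => /rowP E.
  by have := E i; have := E 0; rewrite !tE !mxE !mulr1 => -> ->.
pose g := h 0; have {}tE v : t v = map_mx g v.
  by apply/rowP=> i; rewrite tE hE mxE.
have c0 : c != 0.
  apply/eqP=> c0; move: t1; rewrite c0 scale0r => /t_inj/rowP/(_ 0)/eqP.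
  by rewrite !mxE oner_eq0.
have gD a b : g (a + b) = g a + g b.
  by rewrite /g /h scalerDl tD mxE.
have gM a b : c * g (a * b) = g a * g b.
  (* Comparing two entries of [t (a *: v)] and [t v], which are proportional, shows that [g] is
     multiplicative up to the factor [c]. *)
  pose v : 'rV[L]_3 := \row_i if i == 0 then 1 else b.
  have /vlineP[k /rowP E] := t_line a v; move: (E 0) (E 1).
  rewrite !tE !mxE /= mulr1 -[g 1]/c => -> ->; ring.
pose ta a := c^-1 * g a.
have taB : zmod_morphism ta.
  move=> a b; rewrite /ta -mulrBr; congr (_ * _); apply: (addIr (g b)).
  by rewrite -gD !subrK.
have taM : monoid_morphism ta.
  split=> [|a b]; first by rewrite /ta mulVf.
  by rewrite /ta -[g (a * b)](mulKf c0) gM; ring.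
pose tau : {rmorphism L -> L} := HB.pack ta
  (GRing.isZmodMorphism.Build L L ta taB) (GRing.isMonoidMorphism.Build L L ta taM).
exists c, tau; split=> // [v|k].
  by rewrite tE; apply/rowP=> i; rewrite !mxE /tau /= /ta mulVKf.
have := tE (iota k *: const_mx 1); rewrite tZ t1 => /rowP/(_ 0); rewrite !mxE !mulr1.
by rewrite /tau /= /ta => <-; rewrite mulrCA mulVf // mulr1.
Qed.

(** * Normal form of the collineation in the Bose representation *)

Section BoseNormalForm.
Variables (F L : finFieldType) (iota : {rmorphism F -> L}).
Variable theta : {linear 'rV[F]_9 -> 'rV[L]_3 | iota \; *:%R}.
Variables (theta' : 'rV[L]_3 -> 'rV[F]_9).
Variables (phi : {perm {vspace 'rV[L]_3}}) (sigma : {perm {vspace 'rV[F]_9}}).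
Variable s : 'End('rV[F]_9).
Hypothesis thetaK : cancel theta theta'.
Hypothesis theta'K : cancel theta' theta.
Hypothesis s_inj : lker s == 0%VS.
Hypothesis sigmaE : forall U, sigma U = (s @: U)%VS.
Hypothesis sigma_phi : forall P, is_point P ->
  sigma (bose theta P) = bose theta (phi P).
Implicit Types (x y : 'rV[F]_9) (v w : 'rV[L]_3) (P : {vspace 'rV[L]_3}).

Lemma thetaZ k x : theta (k *: x) = iota k *: theta x.
Proof. by rewrite linearZ_LR. Qed.

Lemma theta_eq0 x : (theta x == 0) = (x == 0).
Proof. by rewrite -[0 in LHS](linear0 theta) (can_eq thetaK). Qed.

Lemma s_ker0 x : (s x == 0) = (x == 0).
Proof. by rewrite -memv_ker (eqP s_inj) memv0. Qed.

Lemma card_bose P : #|[set x in bose theta P]| = #|[set v in P]|.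
Proof.
rewrite -(card_imset _ (can_inj thetaK)); apply: eq_card => v; rewrite inE.
apply/imsetP/idP => [[x]|vP]; first by rewrite inE mem_bose => xP ->.
by exists (theta' v); rewrite ?theta'K // inE mem_bose theta'K.
Qed.

(** The Bose planes of a point and of its image have equally many vectors, so the image is a point,
    and it contains [theta (s x)]. *)
Lemma phi_vline x : x != 0 -> phi <[theta x]>%VS = <[theta (s x)]>%VS.
Proof.
move=> x0; set P := <[theta x]>%VS.
have tx0 : theta x != 0 by rewrite theta_eq0.
have ptP : is_point P by apply/is_pointP; exists (theta x).
have bE : bose theta (phi P) = (s @: bose theta P)%VS by rewrite -sigmaE sigma_phi.
have dimP : \dim (phi P) = 1%N.
  apply: dim_vspace_card; rewrite -card_bose bE card_mem_vspace limg_dim_eq.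
    by rewrite -card_mem_vspace card_bose card_mem_vspace dim_vline tx0.
  by rewrite (eqP s_inj) capv0.
apply/esym/eqP; rewrite eqEdim dimP dim_vline theta_eq0 s_ker0 x0 andbT -memvE.
by rewrite -mem_bose bE memv_img // mem_bose memv_line.
Qed.

Variables (M : 'M[L]_3) (U : {vspace 'rV[F]_9}) (k : F).
Hypothesis M_unit : M \in unitmx.
Hypothesis phi_coll : collineation phi.
Hypothesis phi_nontrivial : phi != 1%g.
Hypothesis phi_fix : forall y : 'rV[F]_3, y != 0 ->
  phi <[map_mx iota y *m M]>%VS = <[map_mx iota y *m M]>%VS.
Hypothesis sigma3 : (sigma ^+ 3)%g = 1%g.
Hypothesis U_proper : U != fullv.
Hypothesis s_modU : forall x, s x - k *: x \in U.

(** As [sigma] has trivial cube, s^3 is a scalar; its value is seen modulo [U], where [s] is [k]. *)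
Lemma s_cube x : s (s (s x)) = k ^+ 3 *: x.
Proof.
have [|l lE] := scalar_of_vlines _ _ _ \1%VF (s \o (s \o s))%VF.
  move=> y; rewrite !comp_lfunE /= id_lfunE.
  have := congr1 (fun f : {perm _} => f <[y]>%VS) sigma3.
  by rewrite permX perm1 /= !sigmaE !limg_line => <-; rewrite memv_line.
have {}lE y : s (s (s y)) = l *: y by have := lE y; rewrite !comp_lfunE /= id_lfunE.
rewrite lE; suff -> : l = k ^+ 3 by [].
have [z zU] : exists z, z \notin U.
  apply/existsP; rewrite -[X in is_true X]negbK negb_exists; apply: contra U_proper.
  by move/forallP=> H; apply/eqP/vspaceP=> z; rewrite memvf; have := H z; rewrite negbK.
have sU y : y \in U -> s y \in U.
  by move=> yU; rewrite -(subrK (k *: y) (s y)) memvD ?memvZ.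
have : (l - k ^+ 3) *: z \in U.
  (* The factorization s^3 - k^3 = (s^2 + k s + k^2)(s - k), applied to [z]. *)
  rewrite (_ : _ *: z = s (s (s z - k *: z)) + k *: s (s z - k *: z)
      + k ^+ 2 *: (s z - k *: z)); last first.
    rewrite !linearB /= !linearZ /= linearZ /= lE.
    by apply/rowP=> i; rewrite !mxE; ring.
  by rewrite !memvD ?memvZ ?sU.
by rewrite rpredZeq (negPf zU) orbF subr_eq0 => /eqP.
Qed.

Lemma k_neq0 : k != 0.
Proof.
apply: contra U_proper => /eqP k0; apply/eqP/vspaceP=> x; rewrite memvf.
have : s (s (s x)) == 0 by rewrite s_cube k0 expr0n scale0r.
by rewrite !s_ker0 => /eqP ->; rewrite mem0v.
Qed.

(** In subplane coordinates [s] is [c] times an automorphism [tau]. The factor [c / iota k] has norm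
    1, so Hilbert 90 writes it as [b / tau b], and dividing the coordinates by [b] removes it. *)
Lemma bose_normal_form : exists (tau : {rmorphism L -> L}) (b : L),
  [/\ forall a, tau (tau (tau a)) = a, forall l, tau (iota l) = iota l,
      exists a, tau a != a, b != 0
    & forall x, b^-1 *: (theta (k^-1 *: s x) *m invmx M)
        = map_mx tau (b^-1 *: (theta x *m invmx M))].
Proof.
pose t v := theta (s (theta' (v *m M))) *m invmx M.
have tE x : t (theta x *m invmx M) = theta (s x) *m invmx M.
  by rewrite /t mulmxKV // thetaK.
have t0 : t 0 = 0 by rewrite /t mul0mx -(linear0 theta) thetaK !linear0 mul0mx.
have tP v : exists x, v = theta x *m invmx M.
  by exists (theta' (v *m M)); rewrite theta'K mulmxK.
have [||||y|c [tau [c0 tauE tau_iota]]] := semilinear_of_subplane F L iota t.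
- move=> v w; have [x ->] := tP v; have [y ->] := tP w.
  by rewrite -mulmxDl -linearD !tE !linearD /= mulmxDl.
- move=> v; have [x ->] := tP v; rewrite tE => E.
  have /eqP : theta (s x) = 0 by rewrite -(mulmxKV M_unit (theta _)) E mul0mx.
  by rewrite theta_eq0 s_ker0 => /eqP ->; rewrite linear0 mul0mx.
- move=> a v; have [x ->] := tP v; rewrite tE.
  have [-> |a0] := eqVneq a 0; first by rewrite scale0r t0 mem0v.
  have [-> |x0] := eqVneq x 0; first by rewrite !linear0 mul0mx scaler0 t0 mem0v.
  have [y yE] : exists y, a *: theta x = theta y.
    by exists (theta' (a *: theta x)); rewrite theta'K.
  have y0 : y != 0 by rewrite -theta_eq0 -yE scaler_eq0 negb_or a0 theta_eq0.
  rewrite scalemxAl yE tE.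
  have : <[theta (s y)]>%VS = <[theta (s x)]>%VS.
    rewrite -!phi_vline //; congr (phi _); apply/eqP; rewrite vline_eqE ?theta_eq0 //.
    by rewrite -yE memvZ ?memv_line.
  move/eqP; rewrite vline_eqE ?theta_eq0 ?s_ker0 // => /vlineP[l ->].
  by rewrite -scalemxAl memvZ ?memv_line.
- move=> l v; have [x ->] := tP v.
  by rewrite scalemxAl -thetaZ !tE linearZ /= thetaZ scalemxAl.
- have [-> |y0] := eqVneq y 0.
    by rewrite map_mx0 t0 mem0v.
  have [x xE] := tP (map_mx iota y); rewrite xE tE.
  have x0 : x != 0.
    apply: contraNneq y0 => x0; move: xE; rewrite x0 linear0 mul0mx => /rowP E.
    by apply/eqP/rowP=> i; apply: (fmorph_inj iota); have := E i; rewrite !mxE rmorph0.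
  have := phi_fix y y0; rewrite xE mulmxKV // phi_vline // => /eqP.
  rewrite vline_eqE ?theta_eq0 ?s_ker0 // => /vlineP[l ->].
  by rewrite -scalemxAl memvZ ?memv_line.
have thetaE x : theta (s x) *m invmx M = c *: map_mx tau (theta x *m invmx M).
  by rewrite -tauE tE.
have tau_nontrivial : exists a, tau a != a.
  apply/existsP; rewrite -[X in is_true X]negbK negb_exists.
  apply: contra phi_nontrivial => /forallP H.
  have phi_pt x : x != 0 -> phi <[theta x]>%VS = <[theta x]>%VS.
    move=> x0; rewrite phi_vline //; apply/eqP; rewrite vline_eqE ?theta_eq0 ?s_ker0 //.
    have tauid : map_mx tau (theta x *m invmx M) = theta x *m invmx M.
      by apply/rowP=> i; rewrite mxE; apply/eqP; rewrite -[_ == _]negbK.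
    rewrite -(mulmxKV M_unit (theta (s x))) thetaE tauid -scalemxAl mulmxKV //.
    by rewrite memvZ ?memv_line.
  (* If [tau] were trivial, [phi] would fix every point; as it preserves inclusion, it would fix
     every subspace. *)
  apply/eqP/permP=> W; rewrite perm1; apply/vspaceP=> v.
  have [-> |v0] := eqVneq v 0; first by rewrite !mem0v.
  rewrite -(theta'K v) !memvE -{1}phi_pt ?phi_coll // -theta_eq0 theta'K //.
(* The cube of [s] on a constant row: [a = 1] gives the norm of [c], and cancelling it leaves tau^3
   = 1. *)
have cube a : c * tau c * tau (tau c) * tau (tau (tau a)) = iota k ^+ 3 * a.
  have [x xE] := tP (const_mx a).
  have := congr1 (fun u => theta u *m invmx M) (s_cube x).
  rewrite !thetaE -xE thetaZ -scalemxAl -xE => /rowP/(_ 0).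
  by rewrite !mxE -rmorphXn => <-; rewrite !rmorphM !mulrA.
have ik : iota k != 0 by rewrite fmorph_eq0 k_neq0.
have norm_c : c * tau c * tau (tau c) = iota k ^+ 3.
  by have := cube 1; rewrite !rmorph1 !mulr1.
have tau3 a : tau (tau (tau a)) = a.
  by have := cube a; rewrite norm_c => /mulfI; apply; rewrite expf_neq0.
have [|b b0 bE] := hilbert90 L tau tau3 tau_nontrivial (c / iota k).
  rewrite !fmorph_div /= !tau_iota.
  rewrite (_ : _ * _ = c * tau c * tau (tau c) / iota k ^+ 3); last by field.
  by rewrite norm_c mulfV // expf_neq0.
exists tau, b; split=> // x.
rewrite thetaZ -scalemxAl thetaE map_mxZ !scalerA fmorphV; congr (_ *: _).
have tb0 : tau b != 0 by rewrite fmorph_eq0.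
rewrite fmorphV -[in LHS]bE; field.
by rewrite tb0 ik c0.
Qed.

End BoseNormalForm.

(** * Coordinates adapted to the subplane *)

Section Coordinates.
Variables (F L : finFieldType) (iota : {rmorphism F -> L}).
Variable theta : {linear 'rV[F]_9 -> 'rV[L]_3 | iota \; *:%R}.
Variables (theta' : 'rV[L]_3 -> 'rV[F]_9) (b : L) (M : 'M[L]_3).
Hypothesis thetaK : cancel theta theta'.
Hypothesis theta'K : cancel theta' theta.
Hypothesis b_neq0 : b != 0.
Hypothesis M_unit : M \in unitmx.

Definition coords (x : 'rV[F]_9) : 'rV[L]_3 := b^-1 *: (theta x *m invmx M).
Definition of_coords (v : 'rV[L]_3) : 'rV[F]_9 := theta' (b *: (v *m M)).

Lemma coordsK : cancel coords of_coords.
Proof.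
move=> x; rewrite /of_coords /coords -scalemxAl mulmxKV // scalerA mulfV //.
by rewrite scale1r thetaK.
Qed.

Lemma of_coordsK : cancel of_coords coords.
Proof.
move=> v; rewrite /of_coords /coords theta'K -scalemxAl scalerA mulVf //.
by rewrite scale1r mulmxK.
Qed.

Lemma coordsD : {morph coords : x y / x + y}.
Proof. by move=> x y; rewrite /coords linearD mulmxDl scalerDr. Qed.

Lemma coordsZ k x : coords (k *: x) = iota k *: coords x.
Proof. by rewrite /coords thetaZ -scalemxAl !scalerA mulrC. Qed.

Lemma theta_coords x : theta x = b *: (coords x *m M).
Proof. by rewrite /coords -scalemxAl mulmxKV // scalerA mulfV // scale1r. Qed.

Lemma coords_vline x y :
  (coords x \in <[coords y]>%VS) = (theta x \in <[theta y]>%VS).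
Proof.
apply/vlineP/vlineP => -[k E]; exists k; last first.
  by rewrite /coords E -scalemxAl !scalerA mulrC.
by rewrite !theta_coords E -scalemxAl !scalerA mulrC.
Qed.

Variable S : {set {vspace 'rV[L]_3}}.
Hypothesis S_def : S = [set <[map_mx iota y *m M]>%VS | y : 'rV[F]_3 & y != 0].

(** In these coordinates the points of the subplane are spanned by the rational rows. *)
Lemma I_pointE x : x != 0 ->
  reflect (exists a (y : 'rV[F]_3), coords x = a *: map_mx iota y)
          (I_point theta S <[x]>%VS).
Proof.
move=> x0; apply: (iffP andP) => [[_ /existsP[P]]|[a [y xy]]].
  rewrite -memvE mem_bose /typeI S_def => /andP[/andP[_ /imsetP[y _ ->]] /vlineP[k xk]].
  by exists (b^-1 * k), y; rewrite /coords xk -scalemxAl mulmxK // scalerA.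
have cx0 : coords x != 0.
  by apply: contraNneq x0 => c0; rewrite -(coordsK x) c0 /of_coords mul0mx scaler0
     -(linear0 theta) thetaK.
have y0 : y != 0 by apply: contraNneq cx0 => y0; rewrite xy y0 map_mx0 scaler0.
split; first by apply/is_pointP; exists x.
apply/existsP; exists <[map_mx iota y *m M]>%VS; rewrite -memvE mem_bose /typeI.
have -> : <[map_mx iota y *m M]>%VS \in S.
  by rewrite S_def; apply/imsetP; exists y; rewrite ?inE.
rewrite andbT; apply/andP; split; last first.
  by apply/vlineP; exists (b * a); rewrite theta_coords xy -scalemxAl scalerA.
apply/is_pointP; exists (map_mx iota y *m M) => //.
apply: contraNneq cx0 => E; rewrite xy -(mulmxK M_unit (map_mx iota y)) E mul0mx.
by rewrite scaler0.
Qed.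

End Coordinates.

(** * The counts *)

(** Here [p] stands for points, [l] for fixed lines, [xI] for all nonzero Type I vectors, [yI] and
    [yII] for the non-eigenvectors of each type, and [r] for the number of roots n + 1. *)
Lemma axis_counts (q r pF pI pII lI lII xI yI yII : nat) :
    (2 < q)%N -> (r <= 2)%N ->
    (pF * (q - 1) = r * (q ^ 3 - 1))%N ->
    (xI * (q - 1) = (q ^ 2 - 1) * (q ^ 3 - 1))%N ->
    (yI + r * (q ^ 3 - 1) = xI)%N -> (yII + xI = q ^ 6 - 1)%N ->
    (pI * (q - 1) = yI)%N -> (pII * (q - 1) = yII)%N ->
    (lI * (q ^ 2 - 1 - r * (q - 1)) = yI)%N ->
    (lII * (q ^ 2 - 1 - r * (q - 1)) = yII)%N ->
  let Q : rat := q%:R in let N : rat := r%:R - 1 in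
  [/\ [/\ pF%:R = (N + 1) * (Q ^+ 2 + Q + 1),
          pI%:R = (Q - N) * (Q ^+ 2 + Q + 1)
        & pII%:R = (Q ^+ 3 - Q) * (Q ^+ 2 + Q + 1)],
      lI%:R = Q ^+ 2 + Q + 1
    & lII%:R = (Q ^+ 3 - Q) * (Q ^+ 2 + Q + 1) / (Q - N)].
Proof.
move=> q2 r2; have q1 : (1 <= q)%N by lia.
(* The second factor, equal to [Q - N], is the number of points moved by [sigma] on a fixed line
   spanned by an orbit. *)
have -> : (q ^ 2 - 1 - r * (q - 1) = (q - 1) * (q + 1 - r))%N.
  by rewrite [RHS]mulnBr -(subn_sqr q 1) exp1n [(r * _)%N]mulnC.
pose toQ (a : nat) : rat := a%:R.
move=> /(congr1 toQ) EpF /(congr1 toQ) ExI /(congr1 toQ) EyI /(congr1 toQ) EyII.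
move=> /(congr1 toQ) EpI /(congr1 toQ) EpII /(congr1 toQ) ElI /(congr1 toQ) ElII Q N.
move: EpF ExI EyI EyII EpI EpII ElI ElII.
rewrite /toQ !(natrM, natrD, natrB) ?expn_gt0 ?q1 //; last by lia.
rewrite -/Q => EpF ExI EyI EyII EpI EpII ElI ElII.
have Q1 : Q - 1 != 0 by rewrite subr_eq0 (Num.Theory.eqr_nat _ q 1); lia.
have QN : Q - N != 0.
  have -> : Q - N = (q + 1 - r)%:R by rewrite natrB ?natrD /N; [ring | lia].
  by rewrite Num.Theory.pnatr_eq0; lia.
have {}ExI : xI%:R = (Q + 1) * (Q ^+ 3 - 1) by apply: (mulIf Q1); rewrite ExI; ring.
have {}EyI : yI%:R = (Q - N) * (Q ^+ 3 - 1).
  by rewrite -[LHS](addrK (r%:R * (Q * (Q * Q) - 1))) EyI ExI /N; ring.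
have {}EyII : yII%:R = (Q ^+ 3 - Q) * (Q ^+ 3 - 1).
  by rewrite -[LHS](addrK xI%:R) EyII ExI; ring.
split; first split.
- by apply: (mulIf Q1); rewrite EpF /N; ring.
- by apply: (mulIf Q1); rewrite EpI EyI; ring.
- by apply: (mulIf Q1); rewrite EpII EyII; ring.
- apply: (mulIf (mulf_neq0 Q1 QN)); rewrite -[RHS]mulr1.
  have -> : lI%:R * ((Q - 1) * (Q - N)) = yI%:R by rewrite -ElI /N; ring.
  by rewrite EyI; ring.
apply: (mulIf QN); rewrite divfK //; apply: (mulIf Q1).
have -> : lII%:R * (Q - N) * (Q - 1) = yII%:R by rewrite -ElII /N; ring.
by rewrite EyII; ring.
Qed.

Theorem theorem7 (q : nat) (n : int) (F L : finFieldType)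
    (iota : {rmorphism F -> L})
    (theta : {linear 'rV[F]_9 -> 'rV[L]_3 | iota \; *:%R})
    (S : {set {vspace 'rV[L]_3}}) (phi : {perm {vspace 'rV[L]_3}})
    (sigma : {perm {vspace 'rV[F]_9}}) (Pi : {vspace 'rV[F]_9})
    (q_gt2 : (2 < q)%N) (cardF : #|F| = q) (cardL : #|L| = (q ^ 3)%N)
    (n_range : n \in [:: -1; 0; 1]) (q_mod3 : (q%:Z = n %[mod 3])%Z)
    (theta_bij : bijective theta)
    (S_subplane : Fq_subplane iota S)
    (phi_coll : collineation phi) (phi_order : #[phi]%g = 3%N)
    (phi_fix : forall P, P \in S -> phi P = P)
    (sigma_proj : projectivity sigma) (sigma_order : #[sigma]%g = 3%N)
    (sigma_phi : forall P, is_point P ->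
       sigma (bose theta P) = bose theta (phi P))
    (Pi_fix : hwise_fixed_5space sigma Pi) :
  let Q : rat := q%:R in
  let N : rat := n%:~R in
  let g : rat := (gcdn 3 (q - 1))%:R in
  [/\ [/\ count_in Pi (fixed_point sigma) = (N + 1) * (Q ^+ 2 + Q + 1),
          count_in Pi (I_dots_point theta S sigma)
            = (Q - N) * (Q ^+ 2 + Q + 1)
        & count_in Pi (II_dots_point theta phi sigma)
            = (Q ^+ 3 - Q) * (Q ^+ 2 + Q + 1)],
      [/\ count_in Pi (ptwise_fixed_line sigma)
            = (N + 1) * (Q ^+ 2 + Q + 1),
          count_in Pi (fixed_I_line theta S sigma) = Q ^+ 2 + Q + 1
        & count_in Pi (fixed_II_line theta phi sigma)
            = (Q ^+ 3 - Q) * (Q ^+ 2 + Q + 1) / (Q - N)]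
    & [/\ count_in Pi (ptwise_fixed_plane sigma) = N + 1,
          #|[set U : {vspace 'rV[F]_9} |
              ptwise_fixed_plane sigma U && ~~ (U <= Pi)%VS]|%:R
            = g - (N + 1)
        & forall U : {vspace 'rV[F]_9},
            ptwise_fixed_plane sigma U -> ~~ (U <= Pi)%VS ->
            (U :&: Pi)%VS = 0%VS]].
Proof.
move=> Q N g; have [theta' thetaK theta'K] := theta_bij.
have [M M_unit S_def] := S_subplane; have [s [s_inj sigmaE]] := sigma_proj.
have [dimPi hfixPi] := Pi_fix; rewrite /kspace in dimPi; rewrite -cardF in cardL.
have dimV : \dim {: 'rV[F]_9} = 9%N by rewrite dimvf /dim /= mul1n.
(* Projective dimension 5 is vector dimension 6, so [Pi] has codimension 3. *)
have [||k s_modPi] := scalar_mod_hwise_fixed _ _ s Pi.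
- by rewrite dimV (eqP dimPi).
- move=> W dimW sub; rewrite -sigmaE; apply: hfixPi => //.
  by rewrite /kspace dimW (eqP dimPi).
have Pi_proper : Pi != fullv.
  by apply: contraTneq dimPi => ->; rewrite dimV.
have sigma3 : (sigma ^+ 3 = 1)%g by have := expg_order sigma; rewrite sigma_order.
have phi_nt : phi != 1%g by apply: contra_eq_neq phi_order => ->; rewrite order1.
have phi_fixM (y : 'rV[F]_3) : y != 0 ->
    phi <[map_mx iota y *m M]>%VS = <[map_mx iota y *m M]>%VS.
  by move=> y0; apply: phi_fix; rewrite S_def; apply/imsetP; exists y; rewrite ?inE.
have k0 := k_neq0 F sigma s s_inj sigmaE Pi k sigma3 Pi_proper s_modPi.
have [tau [b [tau3 tau_iota tau_nt b0 tauE]]] := bose_normal_form F L iota theta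
  theta' phi sigma s thetaK theta'K s_inj sigmaE sigma_phi M Pi k M_unit
  phi_coll phi_nt phi_fixM sigma3 Pi_proper s_modPi.
(* The rescaled map still induces [sigma], and in the coordinates [psi] it is exactly [tau]. *)
pose s' : 'End('rV[F]_9) := k^-1 *: s.
have s'E x : s' x = k^-1 *: s x by rewrite scale_lfunE.
pose psi := coords F L iota theta b M; pose psi' := of_coords F L theta' b M.
have psiK : cancel psi psi' := coordsK F L iota theta theta' b M thetaK b0 M_unit.
have psi'K : cancel psi' psi := of_coordsK F L iota theta theta' b M theta'K b0 M_unit.
have psiD : {morph psi : x y / x + y} := coordsD F L iota theta b M.
have psiZ := coordsZ F L iota theta b M.
have psi_s x : psi (s' x) = map_mx tau (psi x) by rewrite s'E; apply: tauE.
have sigmaE' U : sigma U = (s' @: U)%VS.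
  rewrite sigmaE; apply/vspaceP=> y; apply/memv_imgP/memv_imgP => -[x xU ->].
    by exists (k *: x); rewrite ?memvZ // s'E linearZ scalerA mulVf // scale1r.
  by exists (k^-1 *: x); rewrite ?memvZ // s'E linearZ.
(* Since [s] is [k] modulo [Pi], the image of s' - 1 lies in [Pi]; this image is the axis, and both
   have dimension 6. *)
have PiE : Pi = axis F s'.
  apply/esym/eqP; rewrite eqEdim.
  rewrite (dim_axis F L iota tau tau3 tau_iota tau_nt cardL psi psi') //.
  rewrite (eqP dimPi) andbT (axis_limg F L iota tau tau3 tau_iota tau_nt cardL psi psi') //.
  apply/subvP=> _ /memv_imgP[x _ ->]; rewrite add_lfunE opp_lfunE id_lfunE s'E.
  rewrite (_ : _ - _ = k^-1 *: (s x - k *: x)) ?memvZ //.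
  by rewrite scalerBr scalerA mulVf // scale1r.
have fixE := fixed_pointE F L tau tau3 psi psi' s' psiK psi_s sigma sigmaE'.
have sigma_vline x : sigma <[x]>%VS = <[s' x]>%VS by rewrite sigmaE' limg_line.
have col_sigma x : x \in axis F s' -> collinear_orbit sigma <[x]>%VS.
  move=> xa; rewrite /collinear_orbit !sigma_vline (axisE F s') //.
  exact: collinear_vlines.
have IE x : x \in axis F s' -> x != 0 -> I_dots_point theta S sigma <[x]>%VS
    = (s' x \notin <[x]>%VS) && pointI F L psi s' x.
  move=> xa x0; rewrite /I_dots_point col_sigma // andbT distinct_orbitE // fixE // andbC.
  congr (_ && _).
  have ptI := I_pointE F L iota theta theta' b M thetaK b0 M_unit S S_def x x0.
  by apply/ptI/(pointIP F L iota tau tau_iota tau_nt cardL psi psi' s' psiK psiZ psi_s).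
have IIE x : x \in axis F s' -> x != 0 -> II_dots_point theta phi sigma <[x]>%VS
    = (s' x \notin <[x]>%VS) && ~~ pointI F L psi s' x.
  move=> xa x0; have tx0 : theta x != 0 by rewrite (theta_eq0 F L iota theta theta').
  have phiE y : y != 0 -> phi <[theta y]>%VS = <[theta (s' y)]>%VS.
    move=> y0; rewrite s'E thetaZ vline_scale ?fmorph_eq0 ?invr_eq0 //.
    exact: (phi_vline F L iota theta theta' phi sigma s).
  have s'x0 : s' x != 0 by rewrite s'E scaler_eq0 invr_eq0 (negPf k0) s_ker0.
  have pIE : pointI F L psi s' x = (phi <[theta x]>%VS == <[theta x]>%VS).
    rewrite phiE // vline_eqE ?(theta_eq0 F L iota theta theta') //.
    exact: coords_vline.
  (* The only point whose Bose plane contains [x] is [<[theta x]>]. On the axis both its orbit under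
     [phi] and the orbit of [<[x]>] under [sigma] are collinear, so only whether [phi] moves it
     matters. *)
  have -> : II_dots_point theta phi sigma <[x]>%VS = ~~ pointI F L psi s' x.
    rewrite /II_dots_point col_sigma // andbT; apply/andP/idP.
      case=> _ /existsP[P]; rewrite -memvE mem_bose.
      case/andP=> /and3P[/is_pointP[v v0 ->] dP _].
      rewrite -vline_eqE // => /eqP xv; rewrite -xv distinct_orbitE // in dP.
      by rewrite pIE.
    move=> nI; split; first by apply/is_pointP; exists x.
    apply/existsP; exists <[theta x]>%VS; rewrite -memvE mem_bose memv_line andbT.
    apply/and3P; split; first by apply/is_pointP; exists (theta x).
      by rewrite distinct_orbitE // -pIE.
    rewrite /collinear_orbit !phiE // (axisE F s') // linearB linearN.
    exact: collinear_vlines.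
  (* The extra condition that [x] is not an eigenvector is automatic, eigenvectors being of Type
     I. *)
  rewrite andbC; case Ix: (pointI _ _ _ _ _) => //=; apply/esym.
  by apply: contraFN Ix; apply: fixed_pointI.
have P_pointI A : I_dots_point theta S sigma A -> is_point A by case/and3P=> /andP[].
have P_pointII A : II_dots_point theta phi sigma A -> is_point A by case/andP=> /andP[].
have cXI := card_pointI F L iota tau tau3 tau_iota tau_nt cardL
  psi psi' s' psiK psi'K psiD psiZ psi_s.
have cXF := card_fixed_vectors F L iota tau tau3 tau_iota tau_nt cardL
  psi psi' s' psiK psi'K psiZ psi_s.
have cXI' := card_axis_pointI F L iota psi s' psiZ.
have cXII := card_axis_pointII F L iota tau tau3 tau_iota tau_nt cardL
  psi psi' s' psiK psi'K psiD psiZ psi_s.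
have cptI := card_P_points F s' _ _ P_pointI IE.
have cptII := card_P_points F s' _ _ P_pointII IIE.
have clI := card_fixed_P_lines F L tau tau3 psi psi' s' psiK psi_s _ _ P_pointI IE
  (fun x y _ _ yx _ Ix => pointI_orbit_line F L iota tau tau_iota tau_nt cardL
     psi psi' s' psiK psiD psiZ psi_s x y Ix yx).
have clII := card_fixed_P_lines F L tau tau3 psi psi' s' psiK psi_s _ _ P_pointII IIE
  (pointII_orbit_line F L iota tau tau_iota tau_nt cardL
     psi psi' s' psiK psiD psiZ psi_s).
have cptl := card_ptwise_fixed_lines F L iota tau tau3 tau_iota tau_nt cardL
  psi psi' s' psiK psi'K psiZ psi_s sigma sigmaE'.
have cpp := card_ptwise_fixed_planes_axis F L iota tau tau3 tau_iota tau_nt cardL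
  psi psi' s' psiK psi'K psiZ psi_s sigma sigmaE'.
have cpn := card_ptwise_fixed_planes_not_axis F L iota tau tau3 tau_iota tau_nt cardL
  psi psi' s' psiK psi'K psiZ psi_s sigma sigmaE'.
have disj := ptwise_fixed_plane_disjoint F L iota tau tau3 tau_iota tau_nt cardL
  psi psi' s' psiK psi'K psiZ psi_s sigma sigmaE'.
have cfix : (#|[set A | (A <= Pi)%VS && fixed_point sigma A]| * (#|F| - 1)
    = #|prim_cube_roots F| * (#|F| ^ 3 - 1))%N.
  rewrite -cXF PiE.
  have -> : [set A | (A <= axis F s')%VS && fixed_point sigma A]
      = [set A | is_point A && ((A <= axis F s')%VS && (sigma A == A))].
    by apply/setP=> A; rewrite !inE /fixed_point andbCA.
  rewrite card_points; apply: eq_card => x; rewrite !inE -memvE andbCA.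
  by case: (eqVneq x 0) => [-> |x0]; rewrite ?andbF //= fixE.
have r_le2 : (#|prim_cube_roots F| <= 2)%N.
  have [r0 r1 r2] := card_prim_cube_roots F; have : (#|F| %% 3 < 3)%N by rewrite ltn_mod.
  by case E: (#|F| %% 3)%N => [|[|[|//]]] _; rewrite ?(r0 E) ?(r1 E) ?(r2 E).
have rE : #|prim_cube_roots F|%:R = N + 1.
  have := card_prim_cube_rootsZ F n n_range; rewrite cardF => /(_ q_mod3) rZ.
  by rewrite -[_%:R]/((#|prim_cube_roots F|)%:Z%:~R) rZ rmorphD.
have NE : N = #|prim_cube_roots F|%:R - 1 by rewrite rE addrK.
have lineE (p : pred {vspace 'rV[F]_9}) :
    [set l | (l <= axis F s')%VS && [&& is_line l, sigma l == l &
       [exists A : {vspace 'rV[F]_9}, p A && (A <= l)%VS]]]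
  = [set l | (l <= axis F s')%VS && [&& is_line l, (s' @: l)%VS == l &
       [exists A : {vspace 'rV[F]_9}, p A && (A <= l)%VS]]].
  by apply/setP=> l; rewrite !inE sigmaE'.
rewrite -lineE in clI; rewrite -lineE in clII.
rewrite cXF in cXI'; rewrite card_cube_roots in cpn.
have := axis_counts _ _ _ _ _ _ _ _ _ _ _ r_le2 cfix cXI cXI' cXII cptI cptII clI clII.
rewrite cardF -NE => /(_ q_gt2) [[]]; rewrite /count_in PiE => -> -> -> -> ->.
rewrite cptl cpp rE natrM rE !natrD natrX cardF; split=> //; split=> //.
by rewrite /g -cardF -cpn natrD rE addrK.
Qed.
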